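(* Let $\beta>1$, $\mathbf{b}\in\mathbb{C}^n\setminus\{0\}$ and $L\in Q_{\mathbf{b},\beta}(\mathbb{B}_n)$. A function $F$ analytic in $\mathbb{B}_n$ is of bounded $L$-index in the direction $\mathbf{b}$ if and only if for every $R$ with $0<R\le\beta$ there exist numbers $P_2(R)\ge1$ and $\eta(R)\in(0,R)$ such that for each $z^0\in\mathbb{B}_n$, each $t_0\in S_{z^0}$ and some $r=r(z^0,t_0)\in[\eta(R),R]$ $$\max\Big\{|F(z^0+t\mathbf{b})|:\ |t-t_0|=\tfrac{r}{L(z^0+t_0\mathbf{b})}\Big\}\le P_2(R)\min\Big\{|F(z^0+t\mathbf{b})|:\ |t-t_0|=\tfrac{r}{L(z^0+t_0\mathbf{b})}\Big\}.$$
   Context: $|\cdot|$ is the Euclidean norm on $\mathbb{C}^n$, $\mathbb{B}_n=\{z\in\mathbb{C}^n:|z|<1\}$, $\mathbb{R}_+=(0,\infty)$, $\mathbb{Z}_+=\{0,1,2,\dots\}$. For $z\in\mathbb{C}^n$, $S_z=\{t\in\mathbb{C}: z+t\mathbf{b}\in\mathbb{B}_n\}$. Directional derivatives: $\frac{\partial^0F}{\partial\mathbf{b}^0}=F$, $\frac{\partial F}{\partial\mathbf{b}}=\sum_{j=1}^n\frac{\partial F}{\partial z_j}b_j$, $\frac{\partial^kF}{\partial\mathbf{b}^k}=\frac{\partial}{\partial\mathbf{b}}\big(\frac{\partial^{k-1}F}{\partial\mathbf{b}^{k-1}}\big)$ for $k\ge2$. For a positive continuous $L$ on $\mathbb{B}_n$,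 an analytic function $F$ in $\mathbb{B}_n$ is of bounded $L$-index in the direction $\mathbf{b}$ if there is $m_0\in\mathbb{Z}_+$ such that for all $m\in\mathbb{Z}_+$ and all $z\in\mathbb{B}_n$ $$\frac{1}{m!L^m(z)}\left|\frac{\partial^mF(z)}{\partial\mathbf{b}^m}\right|\le\max\left\{\frac{1}{k!L^k(z)}\left|\frac{\partial^kF(z)}{\partial\mathbf{b}^k}\right|:0\le k\le m_0\right\}.$$ Class $Q_{\mathbf{b},\beta}(\mathbb{B}_n)$: the set of continuous $L:\mathbb{B}_n\to\mathbb{R}_+$ with $L(z)>\frac{\beta|\mathbf{b}|}{1-|z|}$ for all $z\in\mathbb{B}_n$ and such that $0<\lambda_1^{\mathbf{b}}(\eta)\le\lambda_2^{\mathbf{b}}(\eta)<+\infty$ for every $\eta\in[0,\beta]$, where $\lambda_1^{\mathbf{b}}(\eta)$ and $\lambda_2^{\mathbf{b}}(\eta)$ are respectively the infimum and the supremum of $\frac{L(z+t\mathbf{b})}{L(z+t_0\mathbf{b})}$ over all $z\in\mathbb{B}_n$, $t_0\in S_z$ and $t\in\mathbb{C}$ with $|t-t_0|\le\frac{\eta}{L(z+t_0\mathbf{b})}$ (for such $t$ one has $z+t\mathbf{b}\in\mathbb{B}_n$). *)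

(* Defs.v *)
From HB Require Import structures.
From mathcomp Require Import all_boot all_order all_algebra.
From mathcomp Require Import all_classical all_reals all_analysis.
From mathcomp Require Import complex.

Set Implicit Arguments.
Unset Strict Implicit.
Unset Printing Implicit Defensive.

Import Order.TTheory GRing.Theory Num.Theory.
Import numFieldNormedType.Exports.

Local Open Scope classical_set_scope.
Local Open Scope ring_scope.

(* R[i] gets the topology and the normed-module
   structure over itself that every numFieldType carries, so that
   differentiability on 'rV[R[i]]_n is complex differentiability. *)
HB.instance Definition _ (R : realType) := NormedModule.copy R[i] R[i]^o.

(* `|z| on R[i] is R[i]-valued; cmod is the same modulus with values in R. *)
Notation cmod := ComplexField.Normc.normc.

(* The library norm on 'rV[R[i]]_n is the sup norm; it induces the same
   topology as the Euclidean norm below. *)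
Definition enorm (R : realType) (n : nat) (z : 'rV[R[i]]_n) : R :=
  Num.sqrt (\sum_(j < n) cmod (z 0 j) ^+ 2).

Definition unit_ball (R : realType) (n : nat) : set 'rV[R[i]]_n :=
  [set z | enorm z < 1].

Arguments unit_ball : clear implicits.

Definition slice (R : realType) (n : nat) (b z : 'rV[R[i]]_n) : set R[i] :=
  [set t | unit_ball R n (z + t *: b)].

(* Functions on the ball are total functions on C^n; only their values on the
   ball matter, the ball being open. *)
Definition analytic_in_ball (R : realType) (n : nat)
    (F : 'rV[R[i]]_n -> R[i]) : Prop :=
  forall z, unit_ball R n z -> differentiable F z.

Definition dirder (R : realType) (n : nat) (b : 'rV[R[i]]_n)
    (F : 'rV[R[i]]_n -> R[i]) : 'rV[R[i]]_n -> R[i] :=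
  fun z => \sum_(j < n) 'D_('e_j) F z * b 0 j.

Definition dirdern (R : realType) (n : nat) (b : 'rV[R[i]]_n) (k : nat)
    (F : 'rV[R[i]]_n -> R[i]) : 'rV[R[i]]_n -> R[i] :=
  iter k (dirder b) F.

Definition index_term (R : realType) (n : nat) (b : 'rV[R[i]]_n)
    (L : 'rV[R[i]]_n -> R) (F : 'rV[R[i]]_n -> R[i])
    (z : 'rV[R[i]]_n) (k : nat) : R :=
  cmod (dirdern b k F z) / (k`!%:R * L z ^+ k).

(* The terms being nonnegative where L > 0, the default value 0 of the
   iterated maximum is harmless. *)
Definition bounded_L_index (R : realType) (n : nat) (b : 'rV[R[i]]_n)
    (L : 'rV[R[i]]_n -> R) (F : 'rV[R[i]]_n -> R[i]) : Prop :=
  exists m0 : nat, forall (m : nat) (z : 'rV[R[i]]_n), unit_ball R n z ->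
    index_term b L F z m <=
      \big[Num.max/0]_(0 <= k < m0.+1) index_term b L F z k.

Definition L_ratios (R : realType) (n : nat) (b : 'rV[R[i]]_n)
    (L : 'rV[R[i]]_n -> R) (eta : R) : set (\bar R) :=
  [set q | exists z t0 t, [/\ unit_ball R n z, slice b z t0,
     cmod (t - t0) <= eta / L (z + t0 *: b) &
     q = (L (z + t *: b) / L (z + t0 *: b))%:E]].

Definition lambda1 (R : realType) (n : nat) (b : 'rV[R[i]]_n)
    (L : 'rV[R[i]]_n -> R) (eta : R) : \bar R := ereal_inf (L_ratios b L eta).

Definition lambda2 (R : realType) (n : nat) (b : 'rV[R[i]]_n)
    (L : 'rV[R[i]]_n -> R) (eta : R) : \bar R := ereal_sup (L_ratios b L eta).

Definition class_Q (R : realType) (n : nat) (b : 'rV[R[i]]_n) (beta : R)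
    (L : 'rV[R[i]]_n -> R) : Prop :=
  [/\ {within unit_ball R n, continuous L},
      forall z, unit_ball R n z -> 0 < L z,
      forall z, unit_ball R n z -> beta * enorm b / (1 - enorm z) < L z &
      forall eta, 0 <= eta <= beta ->
        [/\ (0 < lambda1 b L eta)%E, (lambda1 b L eta <= lambda2 b L eta)%E &
            (lambda2 b L eta < +oo)%E]].

Definition circle_values (R : realType) (n : nat) (b : 'rV[R[i]]_n)
    (F : 'rV[R[i]]_n -> R[i]) (z0 : 'rV[R[i]]_n) (t0 : R[i]) (rho : R) : set R :=
  [set cmod (F (z0 + t *: b)) | t in [set t : R[i] | cmod (t - t0) = rho]].

(* When F is continuous on the circle, which is compact and nonempty for
   rho >= 0, this supremum and this infimum are attained, i.e. they are the
   maximum and the minimum. *)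
Definition circle_max (R : realType) (n : nat) (b : 'rV[R[i]]_n)
    (F : 'rV[R[i]]_n -> R[i]) (z0 : 'rV[R[i]]_n) (t0 : R[i]) (rho : R) : R :=
  sup (circle_values b F z0 t0 rho).

Definition circle_min (R : realType) (n : nat) (b : 'rV[R[i]]_n)
    (F : 'rV[R[i]]_n -> R[i]) (z0 : 'rV[R[i]]_n) (t0 : R[i]) (rho : R) : R :=
  inf (circle_values b F z0 t0 rho).

(* Main.v *)
(* For w in the ball let a_k be the Taylor coefficients at 0 of
   s |-> F (w + (s / L w) b), so that |a_k| is the k-th index term at w.
   If the index is at most N, then for every radius r <= 1 some term |a_k| r^k
   with k <= N is maximal. Among N + 2 radii in geometric progression of ratio
   1/25 two have the same maximal index k, and at an intermediate radius the
   k-th term exceeds twice the sum of all the others; hence max / min <= 3 there.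
   Conversely, apply the condition on small circles centred at points of
   |s| = x: each of them meets the disc |s| <= x, so a bound on this disc passes
   to a slightly larger one. After boundedly many steps, starting from x = 1/2,
   max_{|s| <= beta} <= C max_{|s| <= 1/2} <= 2 C max_k |a_k|, and Cauchy's
   estimates |a_m| <= 2 C beta^{-m} max_k |a_k| with beta > 1 bound the index.
   Complex differentiability alone being assumed, Cauchy's formula is obtained
   from Goursat's lemma for a linear homotopy of circles, and integrals of
   continuous functions are increments of primitives. *)
Require Import Defs.
From HB Require Import structures.
From mathcomp Require Import all_boot all_order all_algebra.
From mathcomp Require Import all_classical all_reals all_analysis.
From mathcomp Require Import complex.
From mathcomp Require Import ring lra.
Import Order.TTheory GRing.Theory Num.Theory.
Import numFieldNormedType.Exports.
Local Open Scope classical_set_scope.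
Local Open Scope ring_scope.
Set Implicit Arguments.
Unset Strict Implicit.
Unset Printing Implicit Defensive.

(** The radius finally used lies at least a factor 5 away from two radii at which the same term is
    maximal, whence the ratio 1/25: the other terms fall off like 5^{-j} on either side, and each
    side sums to at most 1/4 of the dominant term. In the converse a small circle must reach back
    into the disc where the bound is known, while L varies with the centre; the condition is
    therefore invoked for the single value min(beta, l1/2), where l1 bounds from below the ratio of
    L at nearby points of the slice to L w. It is not known beforehand that the largest term occurs
    among the first ones, so the argument runs with the supremum S of all terms, finite by Cauchy's
    estimates, and shows that the terms beyond N are at most S/2. The iterated directional
    derivatives are built from partial derivatives of a function assumed differentiable only once;
    that they are differentiable in turn has to be proved before they can be identified with Taylor
    coefficients. *)

Local Notation Re := (@complex.Re _).
Local Notation Im := (@complex.Im _).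

(** * The complex modulus *)

Section Modulus.
Context {R : realType}.
Implicit Types (x y z : R[i]) (a e : R).

Lemma cmodE z : `|z| = (cmod z)%:C%C.
Proof. by case: z. Qed.

Lemma cmod_ge0 z : 0 <= cmod z.
Proof. by case: z => a b; rewrite sqrtr_ge0. Qed.

Lemma cmod0 : cmod (0 : R[i]) = 0. Proof. exact: ComplexField.Normc.normc0. Qed.

Lemma cmod1 : cmod (1 : R[i]) = 1. Proof. exact: ComplexField.Normc.normc1. Qed.

Lemma cmodM x y : cmod (x * y) = cmod x * cmod y.
Proof. exact: ComplexField.Normc.normcM. Qed.

Lemma cmodV x : cmod x^-1 = (cmod x)^-1.
Proof. exact: ComplexField.Normc.normcV. Qed.

Lemma cmodX x k : cmod (x ^+ k) = cmod x ^+ k.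
Proof. by elim: k => [|k IHk]; rewrite ?expr0 ?cmod1 // !exprS cmodM IHk. Qed.

Lemma cmodN x : cmod (- x) = cmod x. Proof. exact: normcN. Qed.

Lemma cmodB x y : cmod (x - y) = cmod (y - x).
Proof. by rewrite -cmodN opprB. Qed.

Lemma ler_cmodD x y : cmod (x + y) <= cmod x + cmod y.
Proof. exact: le_normcD. Qed.

Lemma ler_cmodB x y : cmod (x - y) <= cmod x + cmod y.
Proof. by rewrite -(cmodN y); exact: ler_cmodD. Qed.

Lemma ler_cmod_sub x y : cmod x - cmod y <= cmod (x - y).
Proof. by have := ler_cmodD (x - y) y; rewrite subrK; lra. Qed.

Lemma cmod_eq0 x : (cmod x == 0) = (x == 0).
Proof.
by apply/eqP/eqP => [/ComplexField.Normc.eq0_normc|->]; rewrite ?cmod0.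
Qed.

Lemma cmod_gt0 x : (0 < cmod x) = (x != 0).
Proof. by rewrite lt_neqAle cmod_ge0 andbT eq_sym cmod_eq0. Qed.

Lemma cmodR a : cmod (a%:C%C) = `|a|.
Proof. by rewrite /= expr0n addr0 sqrtr_sqr. Qed.

Lemma cmod_nat k : cmod (k%:R : R[i]) = k%:R.
Proof. by rewrite -(rmorph_nat (real_complex R)) cmodR ger0_norm. Qed.

Lemma ler_cmod_sum I (s : seq I) (P : pred I) (f : I -> R[i]) :
  cmod (\sum_(i <- s | P i) f i) <= \sum_(i <- s | P i) cmod (f i).
Proof.
elim/big_rec2: _ => [|i y x _ le_xy]; first by rewrite cmod0.
by apply: le_trans (ler_cmodD _ _) _; rewrite lerD2l.
Qed.

Lemma ler_Re_cmod z : `|Re z| <= cmod z.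
Proof. by rewrite -lecR; exact: normc_ge_Re. Qed.

(** The topology of [R[i]] is stated with complex tolerances; this turns each of them into a real
    one. *)
Lemma ltc_real (e : R[i]) : 0 < e -> exists2 a, 0 < a & e = a%:C%C.
Proof. by case: e => a b; rewrite ltcE /= => /andP[/eqP -> a0]; exists a. Qed.

Lemma cvg_cmodP (F : set_system R[i]) {FF : Filter F} (f : R[i] -> R[i]) l :
  f @ F --> l <-> forall e, 0 < e -> \forall y \near F, cmod (f y - l) < e.
Proof.
split=> [/cvgrPdist_lt fl e e0|fl].
  have /fl : (0 : R[i]) < e%:C%C by rewrite ltcR.
  by apply: filterS => y; rewrite cmodE ltcR cmodB.
apply/cvgrPdist_lt => _ /ltc_real[e e0 ->].
by have := fl e e0; apply: filterS => y; rewrite cmodE ltcR cmodB.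
Qed.

Lemma nbhs_cmodP z (A : set R[i]) :
  nbhs z A <-> exists2 e, 0 < e & forall y, cmod (y - z) < e -> A y.
Proof.
split=> [/nbhs_ballP[_ /= /ltc_real[e e0 ->] sA]|[e e0 sA]].
  exists e => // y zy; apply: sA.
  by rewrite -ball_normE /= cmodE ltcR cmodB.
apply/nbhs_ballP; exists (e%:C%C) => /=; first by rewrite ltcR.
by move=> y; rewrite -ball_normE /= cmodE ltcR cmodB => /sA.
Qed.

End Modulus.

(** * Bisection *)

Lemma nested_intervals {R : realType} (u v : nat -> R) :
  (forall n, u n <= u n.+1) -> (forall n, v n.+1 <= v n) ->
  (forall n, u n <= v n) -> exists p, forall n, u n <= p <= v n.
Proof.
move=> uS vS uv.
have uh : {homo u : m n / (m <= n)%N >-> m <= n} by exact/nondecreasing_seqP.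
have vh : {homo v : m n / (m <= n)%N >-> n <= m} by exact/nonincreasing_seqP.
have ub m n : u m <= v n.
  apply: (le_trans (uh _ (maxn m n) (leq_maxl _ _))).
  by apply: (le_trans (uv _)); apply: vh; exact: leq_maxr.
exists (sup (range u)) => n; apply/andP; split.
  apply: ub_le_sup; last by exists n.
  by exists (v 0%N) => _ [m _ <-]; exact: ub.
by apply: ge_sup; [exists (u 0%N); exists 0%N | move=> _ [m _ <-]; exact: ub].
Qed.

Lemma exists_lt_half {R : realType} (w e : R) : 0 < e ->
  exists n, forall m, (n <= m)%N -> w / 2 ^+ m < e.
Proof.
move=> e0; exists (Num.bound (w / e)) => m nm.
rewrite ltr_pdivrMr ?exprn_gt0 // mulrC -ltr_pdivrMr //.
by have := Num.Theory.upper_nthrootP nm; apply: le_lt_trans.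
Qed.

(* Compactness of a rectangle, by repeated quartering. *)
Lemma quarter_ind {R : realType} (P : R -> R -> R -> R -> Prop) (x0 y0 w0 h0 : R) :
  0 <= w0 -> 0 <= h0 ->
  (forall x y w h, P x y w h -> P (x + w) y w h -> P x (y + h) w h ->
     P (x + w) (y + h) w h -> P x y (w * 2) (h * 2)) ->
  (forall p q, x0 <= p <= x0 + w0 -> y0 <= q <= y0 + h0 ->
     exists2 d, 0 < d & forall x y w h,
       x0 <= x -> x + w <= x0 + w0 -> y0 <= y -> y + h <= y0 + h0 ->
       x <= p <= x + w -> y <= q <= y + h -> w < d -> h < d -> P x y w h) ->
  P x0 y0 w0 h0.
Proof.
move=> w0_ge0 h0_ge0 glue loc; apply: contrapT => nP.
pose w n := w0 / 2 ^+ n; pose h n := h0 / 2 ^+ n.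
have half (c : R) n : c / 2 ^+ n = c / 2 ^+ n.+1 * 2.
  by rewrite exprS; field; rewrite expf_neq0.
have wS n : w n = w n.+1 * 2 by exact: half.
have hS n : h n = h n.+1 * 2 by exact: half.
have wn_ge0 n : 0 <= w n by rewrite divr_ge0 // exprn_ge0.
have hn_ge0 n : 0 <= h n by rewrite divr_ge0 // exprn_ge0.
pose bad n (q : R * R) := ~ P q.1 q.2 (w n) (h n).
(* The implication sits under the existential so that a successor can be chosen for every corner,
   bad or not. *)
have step n q : exists q', bad n q -> [/\ bad n.+1 q',
    q'.1 = q.1 \/ q'.1 = q.1 + w n.+1 & q'.2 = q.2 \/ q'.2 = q.2 + h n.+1].
  case: (pselect (bad n q)) => [bq|]; last by exists q.
  case: (pselect (bad n.+1 q)) => [b1|b1]; first by exists q => _; split; auto.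
  case: (pselect (bad n.+1 (q.1 + w n.+1, q.2))) => [b2|b2].
    by eexists => _; split; [exact: b2|right|left].
  case: (pselect (bad n.+1 (q.1, q.2 + h n.+1))) => [b3|b3].
    by eexists => _; split; [exact: b3|left|right].
  case: (pselect (bad n.+1 (q.1 + w n.+1, q.2 + h n.+1))) => [b4|b4].
    by eexists => _; split; [exact: b4|right|right].
  exfalso; apply: bq; rewrite wS hS; apply: glue; exact: contrapT.
pose nxt n q := sval (cid (step n q)).
have nxtP n q : bad n q -> [/\ bad n.+1 (nxt n q),
    (nxt n q).1 = q.1 \/ (nxt n q).1 = q.1 + w n.+1 &
    (nxt n q).2 = q.2 \/ (nxt n q).2 = q.2 + h n.+1].
  exact: svalP (cid (step n q)).
pose q := fix q n := if n is m.+1 then nxt m (q m) else (x0, y0).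
have qbad n : bad n (q n).
  elim: n => [|n IHn]; last by have [] := nxtP n _ IHn.
  by rewrite /bad /w /h expr0 !divr1.
have q1S n : (q n).1 <= (q n.+1).1 /\ (q n.+1).1 + w n.+1 <= (q n).1 + w n.
  have [_ H _] := nxtP n _ (qbad n); have := wS n; have := wn_ge0 n.+1.
  by rewrite /=; case: H => ->; lra.
have q2S n : (q n).2 <= (q n.+1).2 /\ (q n.+1).2 + h n.+1 <= (q n).2 + h n.
  have [_ _ H] := nxtP n _ (qbad n); have := hS n; have := hn_ge0 n.+1.
  by rewrite /=; case: H => ->; lra.
have [p pP] : exists p, forall n, (q n).1 <= p <= (q n).1 + w n.
  apply: (@nested_intervals R (fun n => (q n).1) (fun n => (q n).1 + w n)) => n.
  - by have [] := q1S n.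
  - by have [] := q1S n.
  - by rewrite lerDl.
have [r rP] : exists r, forall n, (q n).2 <= r <= (q n).2 + h n.
  apply: (@nested_intervals R (fun n => (q n).2) (fun n => (q n).2 + h n)) => n.
  - by have [] := q2S n.
  - by have [] := q2S n.
  - by rewrite lerDl.
have wh0 : w 0%N = w0 /\ h 0%N = h0 by rewrite /w /h expr0 !divr1.
have inx n : x0 <= (q n).1 /\ (q n).1 + w n <= x0 + w0.
  elim: n => [|n [IH1 IH2]]; first by rewrite wh0.1.
  by have [] := q1S n; lra.
have iny n : y0 <= (q n).2 /\ (q n).2 + h n <= y0 + h0.
  elim: n => [|n [IH1 IH2]]; first by rewrite wh0.2.
  by have [] := q2S n; lra.
have p0 : x0 <= p <= x0 + w0 by have := pP 0%N; rewrite wh0.1.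
have r0 : y0 <= r <= y0 + h0 by have := rP 0%N; rewrite wh0.2.
(* All rectangles of the sequence contain (p, r), so the local hypothesis there contradicts the
   badness of the small ones. *)
have [d d0 dP] := loc p r p0 r0.
have [n1 n1P] := exists_lt_half w0 d0.
have [n2 n2P] := exists_lt_half h0 d0.
have [[? ?] [? ?]] := (inx (maxn n1 n2), iny (maxn n1 n2)).
apply: (qbad (maxn n1 n2)); apply: dP => //.
- by apply: n1P; exact: leq_maxl.
- by apply: n2P; exact: leq_maxr.
Qed.

(** * Derivatives and primitives along segments *)

(* The slope of [f] at [z] within [D] extends to a function tending to [d]
   (Caratheodory's form). With [D] a segment of the real axis this is the
   derivative of a path, with [D] a disc it is complex differentiability. *)
Definition has_deriv {R : realType} (D : set R[i]) (f : R[i] -> R[i])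
    (z d : R[i]) :=
  exists2 g : R[i] -> R[i], g @ within D (nbhs z) --> d &
    forall y, D y -> f y - f z = g y * (y - z).

Section Derivative.
Context {R : realType}.
Implicit Types (D E : set R[i]) (f g : R[i] -> R[i]) (z d : R[i]).

Lemma cvg_withinP D f z d : f @ within D (nbhs z) --> d <->
  forall e, 0 < e -> exists2 r, 0 < r &
    forall y, D y -> cmod (y - z) < r -> cmod (f y - d) < e.
Proof.
rewrite cvg_cmodP; split=> H e e0.
  by have [r r0 rP] := (nbhs_cmodP _ _).1 (H e e0); exists r => // y Dy /rP; apply.
have [r r0 rP] := H e e0; apply/nbhs_cmodP; exists r => // y yz Dy.
exact: rP.
Qed.

Lemma has_derivP D f z d : D z -> has_deriv D f z d <->
  forall e, 0 < e -> exists2 r, 0 < r &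
    forall y, D y -> cmod (y - z) < r ->
      cmod (f y - f z - d * (y - z)) <= e * cmod (y - z).
Proof.
move=> Dz; split=> [[g gd gE] e e0|H].
  have [r r0 rP] := (cvg_withinP _ _ _ _).1 gd e e0.
  exists r => // y Dy yz; rewrite gE // -mulrBl cmodM.
  by rewrite ler_wpM2r ?cmod_ge0 // ltW // rP.
exists (fun y => if y == z then d else (f y - f z) / (y - z)); last first.
  move=> y Dy; case: eqP => [->|/eqP yz]; first by rewrite !subrr mulr0.
  by rewrite divfK // subr_eq0.
apply/cvg_withinP => e e0.
have [r r0 rP] := H (e / 2) (divr_gt0 e0 (ltr0Sn _ _)).
exists r => // y Dy yr; case: eqP => [_|/eqP yz]; first by rewrite subrr cmod0.
have yz0 : 0 < cmod (y - z) by rewrite cmod_gt0 subr_eq0.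
rewrite -(ltr_pM2r yz0) -cmodM mulrBl divfK ?subr_eq0 //.
by apply: le_lt_trans (rP y Dy yr) _; rewrite ltr_pM2r //; lra.
Qed.

Let cvgDc (F : set_system R[i]) {FF : Filter F} f g (a b : R[i]) :
  f @ F --> a -> g @ F --> b -> (fun y => f y + g y) @ F --> a + b.
Proof. exact: (@cvgD R[i] R[i] R[i] F FF f g a b). Qed.

Let cvgMc (F : set_system R[i]) {FF : Filter F} f g (a b : R[i]) :
  f @ F --> a -> g @ F --> b -> (fun y => f y * g y) @ F --> a * b.
Proof. exact: (@cvgM R[i] _ F FF f g a b). Qed.

Let cvg_id D z : id @ within D (nbhs z) --> z.
Proof. exact: cvg_within. Qed.

Lemma has_deriv_cvg D f z d : has_deriv D f z d ->
  f @ within D (nbhs z) --> f z.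
Proof.
move=> [g gd gE].
have : (fun y => g y * (y - z) + f z) @ within D (nbhs z) --> d * (z - z) + f z.
  apply: cvgDc (cvg_cst _); apply: (cvgMc gd).
  exact: (@cvgDc _ _ id (fun=> - z) z (- z) (@cvg_id D z) (cvg_cst _)).
rewrite subrr mulr0 add0r; apply: cvg_trans.
apply: near_eq_cvg; apply/nbhs_cmodP; exists 1 => // y _ Dy.
by rewrite -gE // subrK.
Qed.

Lemma has_deriv_subset D E f z d : E `<=` D -> has_deriv D f z d ->
  has_deriv E f z d.
Proof.
move=> ED [g gd gE]; exists g; last by move=> y /ED /gE.
apply/cvg_withinP => e /((cvg_withinP _ _ _ _).1 gd)[r r0 rP].
by exists r => // y /ED /rP.
Qed.

Lemma eq_has_deriv D f g z d : D z -> (forall y, D y -> f y = g y) ->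
  has_deriv D f z d -> has_deriv D g z d.
Proof.
by move=> Dz fg [h hd hE]; exists h => // y Dy; rewrite -!fg // hE.
Qed.

Lemma has_deriv_cst D c z : has_deriv D (fun=> c) z 0.
Proof.
by exists (fun=> 0) => [|y _]; [exact: cvg_cst | rewrite subrr mul0r].
Qed.

Lemma has_deriv_id D z : has_deriv D id z 1.
Proof. by exists (fun=> 1) => [|y _]; [exact: cvg_cst | rewrite mul1r]. Qed.

Lemma has_derivD D f g z d d' : has_deriv D f z d -> has_deriv D g z d' ->
  has_deriv D (fun y => f y + g y) z (d + d').
Proof.
move=> [f1 f1d f1E] [g1 g1d g1E]; exists (fun y => f1 y + g1 y).
  exact: cvgDc f1d g1d.
by move=> y Dy; rewrite mulrDl -f1E // -g1E //; ring.
Qed.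

Lemma has_derivM D f g z d d' : has_deriv D f z d -> has_deriv D g z d' ->
  has_deriv D (fun y => f y * g y) z (d * g z + f z * d').
Proof.
move=> [f1 f1d f1E] [g1 g1d g1E]; exists (fun y => f1 y * g z + f y * g1 y).
  apply: cvgDc (cvgMc f1d (cvg_cst _)) (cvgMc _ g1d).
  by apply: has_deriv_cvg; exists f1; [exact: f1d|].
move=> y Dy; rewrite mulrDl mulrAC -f1E // -mulrA -g1E //; ring.
Qed.

Lemma has_derivZ D c f z d : has_deriv D f z d ->
  has_deriv D (fun y => c * f y) z (c * d).
Proof.
by move=> fd; have := has_derivM (has_deriv_cst D c z) fd; rewrite mul0r add0r.
Qed.

Lemma has_derivB D f g z d d' : has_deriv D f z d -> has_deriv D g z d' ->
  has_deriv D (fun y => f y - g y) z (d - d').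
Proof.
move=> fd /(has_derivZ (-1)) gd; have := has_derivD fd gd.
rewrite mulN1r; congr (has_deriv _ _ _ _).
by apply/funext => y; rewrite mulN1r.
Qed.

Lemma has_deriv_comp D E f g z d d' : D z -> (forall y, D y -> E (g y)) ->
  has_deriv D g z d -> has_deriv E f (g z) d' ->
  has_deriv D (fun y => f (g y)) z (d' * d).
Proof.
move=> Dz gDE gd fd; have gc := has_deriv_cvg gd.
case: gd fd => g1 g1d g1E [f1 f1d f1E].
exists (fun y => f1 (g y) * g1 y).
  apply: cvgMc g1d.
  apply/cvg_withinP => e e0.
  have [r r0 rP] := (cvg_withinP _ _ _ _).1 f1d e e0.
  have [s s0 sP] := (cvg_withinP _ _ _ _).1 gc r r0.
  by exists s => // y Dy ys; apply: rP; [exact: gDE | exact: sP].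
by move=> y Dy; rewrite f1E ?g1E // ?mulrA //; exact: gDE.
Qed.

Lemma has_derivV D g z d : D z -> (forall y, D y -> g y != 0) ->
  has_deriv D g z d -> has_deriv D (fun y => (g y)^-1) z (- d / g z ^+ 2).
Proof.
move=> Dz g0 gd; have gc := has_deriv_cvg gd.
case: gd => g1 g1d g1E; exists (fun y => - g1 y / (g y * g z)).
  rewrite expr2; apply: cvgMc; first exact: (cvgN g1d).
  apply: (@cvgV R[i]); first by rewrite mulf_neq0 ?g0.
  exact: cvgMc gc (cvg_cst _).
move=> y Dy; rewrite mulrAC mulNr -g1E //.
have [gy gz] := (g0 _ Dy, g0 _ Dz).
by field; rewrite gy gz.
Qed.

End Derivative.

(** * Primitives on real segments and the mean value inequality *)

Section Segment.
Context {R : realType}.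
Implicit Types (a b x : R) (P phi : R[i] -> R[i]).

Definition segment a b : set R[i] := [set t | Im t = 0 /\ a <= Re t <= b].

Lemma segmentR a b x : a <= x <= b -> segment a b x%:C%C.
Proof. by []. Qed.

Lemma segmentE a b t : segment a b t -> t = (Re t)%:C%C.
Proof. by case: t => x y [/= ->]. Qed.

(** Slopes are taken within the segment, so the derivative is one-sided at the end points. *)
Definition primitive a b phi P :=
  forall t, segment a b t -> has_deriv (segment a b) P t (phi t).

Lemma primitive_subset a b a' b' phi P : a <= a' -> b' <= b ->
  primitive a b phi P -> primitive a' b' phi P.
Proof.
move=> aa' bb' Pphi; have sub : segment a' b' `<=` segment a b.
  by move=> t [t0 /andP[? ?]]; split => //; lra.
by move=> t /[dup] ts /sub /Pphi; exact: has_deriv_subset.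
Qed.

(** Mean value inequality for complex values, where no intermediate point is available: with the
    slope bound [M + e'] the inequality adds up over adjacent intervals, and on a short interval
    around [p] it follows from the derivative at [p]. *)
Lemma primitive_le a b phi P M : a <= b -> primitive a b phi P ->
  (forall t, segment a b t -> cmod (phi t) <= M) ->
  cmod (P b%:C%C - P a%:C%C) <= M * (b - a).
Proof.
move=> ab Pphi phiM; apply/ler_addgt0Pr => e e0.
have ba_ge0 : 0 <= b - a by rewrite subr_ge0.
pose e' := e / (b - a + 1).
have e'0 : 0 < e' by apply: divr_gt0 => //; lra.
suff : cmod (P (a + (b - a))%:C%C - P a%:C%C) <= (M + e') * (b - a).
  rewrite subrKC => /le_trans; apply; rewrite mulrDl lerD2l /e' mulrAC.
  by rewrite ler_pdivrMr; nra.
(* With height 0 the quartering is a bisection of the interval. *)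
apply: (@quarter_ind R (fun x _ w _ =>
  cmod (P (x + w)%:C%C - P x%:C%C) <= (M + e') * w) a 0 (b - a) 0) => //.
  move=> x _ w _ H1 H2 _ _.
  have -> : P (x + w * 2)%:C%C - P x%:C%C =
    (P (x + w + w)%:C%C - P (x + w)%:C%C) + (P (x + w)%:C%C - P x%:C%C).
    by rewrite (_ : x + w * 2 = x + w + w); [ring | lra].
  by apply: le_trans (ler_cmodD _ _) _; lra.
move=> p q pab _; have psab : segment a b p%:C%C by apply: segmentR; lra.
have [r r0 rP] := (has_derivP _ _ psab).1 (Pphi _ psab) e' e'0.
exists r => // x _ w _ ax xw _ _ pxw _ wr _.
have near u : a <= u <= b -> `|u - p| < r ->
    cmod (P u%:C%C - P p%:C%C) <= (M + e') * `|u - p|.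
  move=> uab up; have := rP u%:C%C (segmentR uab).
  rewrite -rmorphB cmodR => /(_ up) H.
  have -> : P u%:C%C - P p%:C%C = (P u%:C%C - P p%:C%C -
     phi p%:C%C * (u - p)%:C%C) + phi p%:C%C * (u - p)%:C%C by ring.
  apply: le_trans (ler_cmodD _ _) _; rewrite addrC mulrDl lerD //.
  by rewrite cmodM cmodR ler_wpM2r // phiM.
have Hx : `|x - p| = p - x by rewrite ler0_norm; lra.
have Hw : `|x + w - p| = x + w - p by rewrite ger0_norm; lra.
have := near x; have := near (x + w); rewrite Hx Hw => H1 H2.
(* The interval contains [p]; the estimates on the two sides of [p] add up. *)
have -> : P (x + w)%:C%C - P x%:C%C =
  (P (x + w)%:C%C - P p%:C%C) - (P x%:C%C - P p%:C%C) by ring.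
apply: le_trans (ler_cmodB _ _) _.
have := H1 ltac:(lra) ltac:(lra); have := H2 ltac:(lra) ltac:(lra); lra.
Qed.

(** The difference of two primitives has derivative 0, so the mean value inequality applies with
    bound 0. An integral may thus be read off any primitive. *)
Lemma primitive_unique a b phi P Q : a <= b -> primitive a b phi P ->
  primitive a b phi Q -> P b%:C%C - P a%:C%C = Q b%:C%C - Q a%:C%C.
Proof.
move=> ab Pp Qp; apply/eqP; rewrite -subr_eq0 -cmod_eq0 eq_le cmod_ge0 andbT.
have PQ : primitive a b (fun=> 0) (fun t => P t - Q t).
  by move=> t ts; rewrite -(subrr (phi t)); apply: has_derivB; [exact: Pp|exact: Qp].
have := @primitive_le a b _ _ 0 ab PQ; rewrite mul0r => H.
have -> : P b%:C%C - P a%:C%C - (Q b%:C%C - Q a%:C%C) =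
  P b%:C%C - Q b%:C%C - (P a%:C%C - Q a%:C%C) by ring.
by apply: H => t _; rewrite cmod0.
Qed.

End Segment.

(** * Existence of primitives of continuous functions *)

Section Primitive.
Context {R : realType}.
Implicit Types (a b x d : R) (U V : R -> R) (phi : R[i] -> R[i]).

Lemma is_derive_le U x d : is_derive x 1 U d ->
  forall e, 0 < e -> exists2 r, 0 < r &
    forall y, `|y - x| < r -> `|U y - U x - d * (y - x)| <= e * `|y - x|.
Proof.
move=> Ud e e0.
have /cvgrPdist_le/(_ _ e0)/nbhs_ballP[r /= r0 rP] :
    (fun h => h^-1 *: (U (h + x) - U x)) @ (0 : R)^' --> d.
  have [+ <-] := Ud; rewrite /derivable /derive.
  set f := (fun h => _) => /cvg_ex[l fl].
  have <- : f = (fun h => h^-1 *: (U (h + x) - U x)).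
    by apply/funext => h; rewrite /f /= [h *: _]mulr1.
  by rewrite (cvg_lim _ fl).
exists r => // y yx; have [->|yx0] := eqVneq y x.
  by rewrite !subrr mulr0 subrr normr0 mulr0.
have h0 : y - x != 0 by rewrite subr_eq0.
have := rP (y - x); rewrite -ball_normE /= sub0r normrN subrK => /(_ yx h0).
have h1 : 0 < `|y - x| by rewrite normr_gt0.
rewrite -(ler_pM2r h1) -normrM; congr (_ <= _); rewrite -normrN; congr `|_|.
by rewrite /GRing.scale /=; field.
Qed.

Lemma has_deriv_path U V a b (t : R[i]) d d' : segment a b t ->
  is_derive (Re t) 1 U d -> is_derive (Re t) 1 V d' ->
  has_deriv (segment a b) (fun s => (U (Re s) +i* V (Re s))%C) t (d +i* d')%C.
Proof.
move=> ts Ud Vd; apply/has_derivP => // e e0.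
have [r r0 rP] := is_derive_le Ud (divr_gt0 e0 (ltr0Sn _ 1)).
have [r' r'0 r'P] := is_derive_le Vd (divr_gt0 e0 (ltr0Sn _ 1)).
exists (Num.min r r'); first by rewrite lt_min r0.
move=> y ys yt; have E : y - t = (Re y - Re t)%:C%C.
  by rewrite {1}(segmentE ys) {1}(segmentE ts) rmorphB.
move: yt; rewrite E cmodR lt_min => /andP[/rP H /r'P H'].
have -> : ((U (Re y) +i* V (Re y)) - (U (Re t) +i* V (Re t)) -
    (d +i* d') * (Re y - Re t)%:C)%C =
  (U (Re y) - U (Re t) - d * (Re y - Re t))%:C%C +
  'i%C * (V (Re y) - V (Re t) - d' * (Re y - Re t))%:C%C.
  by apply/eqP; rewrite eq_complex /=; apply/andP; split; apply/eqP; ring.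
apply: le_trans (ler_cmodD _ _) _; rewrite cmodM !cmodR.
have -> : cmod ('i%C : R[i]) = 1 by rewrite /= expr0n expr1n add0r sqrtr1.
by lra.
Qed.

(** Precomposing with the clamp [c] onto [a, b], which is 1-Lipschitz, extends [phi] continuously to
    the whole line; the fundamental theorem of calculus then applies to the real and imaginary
    parts. *)
Lemma continuous_has_primitive a b phi : a <= b ->
  (forall t, segment a b t -> phi @ within (segment a b) (nbhs t) --> phi t) ->
  exists P, primitive a b phi P.
Proof.
move=> ab phic; pose c (x : R) := Num.max a (Num.min x b).
have cab x : a <= c x <= b by rewrite le_max lexx /= ge_max ab ge_min lexx orbT.
have cE x : a <= x <= b -> c x = x.
  by move=> /andP[ax xb]; rewrite /c (min_idPl xb) (max_idPr ax).
have minl u v : Num.min u b <= Num.min v b + `|u - v|.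
  rewrite -lerBlDr le_min; have := ler_norm (u - v); have := normr_ge0 (u - v).
  have : Num.min u b <= u by rewrite ge_min lexx.
  have : Num.min u b <= b by rewrite ge_min lexx orbT.
  by move=> *; apply/andP; split; lra.
have maxl u v : Num.max a u <= Num.max a v + `|u - v|.
  rewrite ge_max; have := ler_norm (u - v); have := normr_ge0 (u - v).
  have : a <= Num.max a v by rewrite le_max lexx.
  have : v <= Num.max a v by rewrite le_max lexx orbT.
  by move=> *; apply/andP; split; lra.
have cl x y : `|c x - c y| <= `|x - y|.
  have minn2 : `|Num.min x b - Num.min y b| <= `|x - y|.
    rewrite ler_norml; have := minl x y; have := minl y x.
    by rewrite (distrC y x) => *; apply/andP; split; lra.
  apply: le_trans minn2; rewrite ler_norml /c.
  have := maxl (Num.min x b) (Num.min y b).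
  have := maxl (Num.min y b) (Num.min x b).
  by rewrite (distrC (Num.min y b)) => *; apply/andP; split; lra.
pose psi x := phi (c x)%:C%C.
have psic x e : 0 < e -> exists2 r, 0 < r &
    forall y, `|y - x| < r -> cmod (psi y - psi x) < e.
  have cs : segment a b (c x)%:C%C := segmentR (cab x).
  move=> /((cvg_withinP _ _ _ _).1 (phic _ cs))[r r0 rP]; exists r => // y yx.
  apply: rP; first exact: segmentR.
  by rewrite -rmorphB cmodR; apply: le_lt_trans (cl _ _) yx.
have prim (u : R -> R) : (forall x y, `|u y - u x| <= cmod (psi y - psi x)) ->
    exists U, forall x, a <= x <= b -> is_derive x 1 U (u x).
  move=> upsi; have uc : continuous u.
    move=> x; apply/cvgrPdist_lt => e /psic-/(_ x)[r r0 rP].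
    apply/nbhs_ballP; exists r => // y xy; have : `|y - x| < r.
      by rewrite distrC; exact: xy.
    by move/rP; apply: le_lt_trans; rewrite distrC.
  (* Integrating from [a - 1] and allowing arguments up to [b + 1] makes every point of [a, b]
     interior, so that the derivative exists at the end points too. *)
  exists (fun x => \int[lebesgue_measure]_(t in [set` `[a - 1, x]]) u t)%R.
  move=> x /andP[ax xb].
  have [//||||d1 d2] := @continuous_FTC1_closed R u (a - 1) x (b + 1).
  - by lra.
  - apply: continuous_compact_integrable; first exact: segment_compact.
    exact: continuous_subspaceT.
  - by lra.
  - exact: uc.
  - by apply: DeriveDef; [exact: d1 | rewrite -derive1E; exact: d2].
have [|U Ud] := prim (fun x => Re (psi x)).
  move=> x y; have -> : Re (psi y) - Re (psi x) = Re (psi y - psi x).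
    by case: (psi y) (psi x) => [? ?] [? ?].
  exact: ler_Re_cmod.
have [|V Vd] := prim (fun x => Im (psi x)).
  move=> x y; have -> : Im (psi y) - Im (psi x) = Re ((psi x - psi y) * 'i%C).
    by rewrite ReiNIm; case: (psi y) (psi x) => [? ?] [? ?] /=; ring.
  apply: le_trans (ler_Re_cmod _) _; rewrite cmodM cmodB.
  by rewrite {2}/cmod expr0n expr1n add0r sqrtr1 mulr1.
exists (fun s => (U (Re s) +i* V (Re s))%C) => t ts.
have tab : a <= Re t <= b by case: ts.
have -> : phi t = (Re (psi (Re t)) +i* Im (psi (Re t)))%C.
  by rewrite /psi (cE _ tab) -(segmentE ts); case: (phi t).
by apply: has_deriv_path; [|exact: Ud|exact: Vd].
Qed.

End Primitive.

(** * Goursat's lemma *)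

Section Goursat.
Context {R : realType}.
Implicit Types (a b : R) (g gam dgam Q : R[i] -> R[i]) (D : set R[i]).

Let quad (c d v0 v : R[i]) := c * v + d * ((v - v0) * (v - v0)) / 2.

Let has_deriv_quad D c d v0 v : has_deriv D (quad c d v0) v (c + d * (v - v0)).
Proof.
have h1 := has_derivB (has_deriv_id D v) (has_deriv_cst D v0 v).
have h2 := has_derivD (has_derivZ c (has_deriv_id D v))
  (has_derivZ (d / 2) (has_derivM h1 h1)).
have -> : quad c d v0 = fun y => c * y + d / 2 * ((y - v0) * (y - v0)).
  by apply/funext => y; rewrite /quad; field.
have -> : c + d * (v - v0) = c * 1 + d / 2 * ((1 - 0) * (v - v0) + (v - v0) * (1 - 0)).
  by field.
exact: h2.
Qed.

(** [Q] minus [quad] along [gam] has as derivative the error of the affine approximation at [gam t],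
    times [dgam t]. Its modulus is at most [e * r * K], and the mean value inequality concludes. *)
Let edge_le D g gam dgam Q a b (v0 d : R[i]) (e r K : R) : a <= b -> 0 <= e ->
  (forall t, segment a b t -> D (gam t)) ->
  (forall v, D v -> cmod (v - v0) <= r ->
    cmod (g v - g v0 - d * (v - v0)) <= e * cmod (v - v0)) ->
  (forall t, segment a b t -> cmod (gam t - v0) <= r) ->
  (forall t, segment a b t -> cmod (dgam t) <= K) ->
  primitive a b dgam gam ->
  primitive a b (fun t => g (gam t) * dgam t) Q ->
  cmod (Q b%:C%C - Q a%:C%C -
    (quad (g v0) d v0 (gam b%:C%C) - quad (g v0) d v0 (gam a%:C%C)))
    <= e * r * K * (b - a).
Proof.
move=> ab e0 gamD gd gamr gamK gamP QP.
have prim : primitive a b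
    (fun t => g (gam t) * dgam t - (g v0 + d * (gam t - v0)) * dgam t)
    (fun t => Q t - quad (g v0) d v0 (gam t)).
  move=> t ts; apply: has_derivB; first exact: QP.
  by apply: (has_deriv_comp (E := setT) ts _ (gamP _ ts) (has_deriv_quad _ _ _ _ _)).
have -> (A B A' B' : R[i]) : A - B - (A' - B') = A - A' - (B - B') by ring.
apply: (primitive_le ab prim) => t ts.
rewrite -mulrBl cmodM opprD addrA; apply: ler_pM; rewrite ?cmod_ge0 //; last exact: gamK.
apply: le_trans (gd _ (gamD _ ts) (gamr _ ts)) _.
by apply: ler_wpM2l => //; exact: gamr.
Qed.

(* On a small rectangle [g] is replaced by its affine approximation, whose
   primitive [quad] has no increment along the closed boundary. *)
Lemma goursat D g (z zx zy : R -> R -> R[i]) (PA PB : R -> R[i] -> R[i])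
    x0 y0 w0 h0 (K : R) :
  0 <= w0 -> 0 <= h0 ->
  (forall x y, x0 <= x <= x0 + w0 -> y0 <= y <= y0 + h0 ->
    [/\ D (z x y), cmod (zx x y) <= K, cmod (zy x y) <= K &
        exists d, has_deriv D g (z x y) d]) ->
  (forall y, y0 <= y <= y0 + h0 -> primitive x0 (x0 + w0)
    (fun t => zx (Re t) y) (fun t => z (Re t) y)) ->
  (forall x, x0 <= x <= x0 + w0 -> primitive y0 (y0 + h0)
    (fun t => zy x (Re t)) (fun t => z x (Re t))) ->
  (forall y, y0 <= y <= y0 + h0 -> primitive x0 (x0 + w0)
    (fun t => g (z (Re t) y) * zx (Re t) y) (PA y)) ->
  (forall x, x0 <= x <= x0 + w0 -> primitive y0 (y0 + h0)
    (fun t => g (z x (Re t)) * zy x (Re t)) (PB x)) ->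
  (PB (x0 + w0) (y0 + h0)%:C%C - PB (x0 + w0) y0%:C%C) -
  (PB x0 (y0 + h0)%:C%C - PB x0 y0%:C%C) =
  (PA (y0 + h0) (x0 + w0)%:C%C - PA (y0 + h0) x0%:C%C) -
  (PA y0 (x0 + w0)%:C%C - PA y0 x0%:C%C).
Proof.
move=> w0_ge0 h0_ge0 zP zxP zyP PAP PBP.
pose I x y w h := (PB (x + w) (y + h)%:C%C - PB (x + w) y%:C%C) -
  (PB x (y + h)%:C%C - PB x y%:C%C) -
  ((PA (y + h) (x + w)%:C%C - PA (y + h) x%:C%C) -
  (PA y (x + w)%:C%C - PA y x%:C%C)).
apply/eqP; rewrite -subr_eq0 -/(I x0 y0 w0 h0) -cmod_eq0 eq_le cmod_ge0 andbT.
have K0 : 0 <= K.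
  have [|| _ H _ _] := zP x0 y0; [lra | lra | exact: le_trans (cmod_ge0 _) H].
apply/ler_addgt0Pr => e0 e00; rewrite add0r.
pose e := e0 / ((w0 + h0) ^+ 2 + 1).
have sq_ge0 : 0 <= (w0 + h0) ^+ 2 by rewrite sqr_ge0.
have e_gt0 : 0 < e by rewrite divr_gt0 //; lra.
suff : cmod (I x0 y0 w0 h0) <= e * (w0 + h0) ^+ 2.
  move=> /le_trans; apply; rewrite /e mulrAC ler_pdivrMr; last lra.
  by rewrite ler_wpM2l //; lra.
(* This bound is multiplied by 4 when both sides double, which is exactly what four quarters
   contribute. *)
apply: (@quarter_ind R (fun x y w h => cmod (I x y w h) <= e * (w + h) ^+ 2)) => //.
  move=> x y w h H1 H2 H3 H4.
  have -> : I x y (w * 2) (h * 2) = I x y w h + I (x + w) y w h +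
      (I x (y + h) w h + I (x + w) (y + h) w h).
    have E u v : u + v * 2 = u + v + v :> R by ring.
    by rewrite /I !E; ring.
  apply: le_trans (ler_cmodD _ _) _.
  have -> : e * (w * 2 + h * 2) ^+ 2 = (e * (w + h) ^+ 2 + e * (w + h) ^+ 2) +
    (e * (w + h) ^+ 2 + e * (w + h) ^+ 2) by ring.
  by apply: lerD; apply: le_trans (ler_cmodD _ _) _; apply: lerD.
move=> p q ph qh; have [Dpq _ _ [d gd]] := zP p q ph qh.
(* The four edges together will contribute at most [e' * (2 * K ^+ 2) * (w + h) ^+ 2]; the [+ 1]
   covers [K = 0]. *)
pose e' := e / (2 * K ^+ 2 + 1).
have K2 : 0 <= K ^+ 2 by rewrite exprn_ge0.
have e'0 : 0 < e' by rewrite divr_gt0 //; lra.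
have [r r0 rP] := (has_derivP _ _ Dpq).1 gd e' e'0.
(* For [w] and [h] below this value, [K * (w + h) < r]: the image of the rectangle stays where the
   affine approximation is valid. *)
exists (r / (2 * K + 1)); first by rewrite divr_gt0 //; lra.
move=> x y w h x0x xw y0y yh pxw qyh.
rewrite !ltr_pdivlMr; [move=> wr hr | lra | lra].
have w_ge0 : 0 <= w by lra.
have h_ge0 : 0 <= h by lra.
(* One vertical and one horizontal segment, each traversed with speed at most [K], lead from (p, q)
   to (x', y'). *)
have dist x' y' : x <= x' <= x + w -> y <= y' <= y + h ->
    cmod (z x' y' - z p q) <= K * (w + h).
  have move_le (gam dgam : R[i] -> R[i]) a c u v : primitive a (a + c) dgam gam ->
      (forall t, segment a (a + c) t -> cmod (dgam t) <= K) ->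
      a <= u <= a + c -> a <= v <= a + c ->
      cmod (gam v%:C%C - gam u%:C%C) <= K * c.
    move=> gamP gamK; wlog uv : u v / u <= v.
      by case: (leP u v) => [|/ltW] uv H uh vh; [|rewrite cmodB]; exact: H.
    move=> /andP[au _] /andP[_ vc].
    have uvP := primitive_subset au vc gamP.
    apply: le_trans (primitive_le uv uvP _) _.
      by move=> t [t0 tuv]; apply: gamK; split => //; clear -tuv au vc; lra.
    by apply: ler_wpM2l => //; clear -au vc; lra.
  move=> x'h y'h; have y'0 : y0 <= y' <= y0 + h0 by clear -y'h y0y yh; lra.
  have Hx : cmod (z x' y' - z p y') <= K * w.
    apply: (move_le (fun t => z (Re t) y') (fun t => zx (Re t) y') x) => //.
      exact: (primitive_subset x0x xw (zxP _ y'0)).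
    move=> t [_ tx]; have tx0 : x0 <= Re t <= x0 + w0 by clear -tx x0x xw; lra.
    by have [] := zP (Re t) y' tx0 y'0.
  have Hy : cmod (z p y' - z p q) <= K * h.
    apply: (move_le (fun t => z p (Re t)) (fun t => zy p (Re t)) y) => //.
      exact: (primitive_subset y0y yh (zyP _ ph)).
    move=> t [_ ty]; have ty0 : y0 <= Re t <= y0 + h0 by clear -ty y0y yh; lra.
    by have [] := zP p (Re t) ph ty0.
  have -> : z x' y' - z p q = (z x' y' - z p y') + (z p y' - z p q) by ring.
  by rewrite mulrDr; apply: le_trans (ler_cmodD _ _) _; exact: lerD.
pose s := w + h; pose Lam := quad (g (z p q)) d (z p q).
have Kr : K * s < r by rewrite /s; nra.
have gnear v : D v -> cmod (v - z p q) <= K * s ->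
    cmod (g v - g (z p q) - d * (v - z p q)) <= e' * cmod (v - z p q).
  by move=> Dv vs; apply: rP => //; exact: le_lt_trans Kr.
have EB x' : x <= x' <= x + w -> cmod (PB x' (y + h)%:C%C - PB x' y%:C%C -
    (Lam (z x' (y + h)) - Lam (z x' y))) <= e' * (K * s) * K * h.
  move=> x'h; have E : y + h - y = h by ring.
  have x'0 : x0 <= x' <= x0 + w0 by clear -x'h x0x xw; lra.
  have yyh : y <= y + h by rewrite lerDl.
  have := @edge_le D g (fun t => z x' (Re t)) (fun t => zy x' (Re t)) (PB x')
    y (y + h) (z p q) d e' (K * s) K yyh (ltW e'0).
  rewrite E; apply.
  - move=> t [_ ty]; have ty0 : y0 <= Re t <= y0 + h0 by clear -ty y0y yh; lra.
    by have [] := zP x' (Re t) x'0 ty0.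
  - exact: gnear.
  - by move=> t [_ ty]; exact: dist.
  - move=> t [_ ty]; have ty0 : y0 <= Re t <= y0 + h0 by clear -ty y0y yh; lra.
    by have [] := zP x' (Re t) x'0 ty0.
  - exact: (primitive_subset y0y yh (zyP _ x'0)).
  - exact: (primitive_subset y0y yh (PBP _ x'0)).
have EA y' : y <= y' <= y + h -> cmod (PA y' (x + w)%:C%C - PA y' x%:C%C -
    (Lam (z (x + w) y') - Lam (z x y'))) <= e' * (K * s) * K * w.
  move=> y'h; have E : x + w - x = w by ring.
  have y'0 : y0 <= y' <= y0 + h0 by clear -y'h y0y yh; lra.
  have xxw : x <= x + w by rewrite lerDl.
  have := @edge_le D g (fun t => z (Re t) y') (fun t => zx (Re t) y') (PA y')
    x (x + w) (z p q) d e' (K * s) K xxw (ltW e'0).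
  rewrite E; apply.
  - move=> t [_ tx]; have tx0 : x0 <= Re t <= x0 + w0 by clear -tx x0x xw; lra.
    by have [] := zP (Re t) y' tx0 y'0.
  - exact: gnear.
  - by move=> t [_ tx]; exact: dist.
  - move=> t [_ tx]; have tx0 : x0 <= Re t <= x0 + w0 by clear -tx x0x xw; lra.
    by have [] := zP (Re t) y' tx0 y'0.
  - exact: (primitive_subset x0x xw (zxP _ y'0)).
  - exact: (primitive_subset x0x xw (PAP _ y'0)).
have tri (A B A' B' : R[i]) (a b : R) : cmod A <= a -> cmod B <= a -> cmod A' <= b ->
    cmod B' <= b -> cmod (A - B - (A' - B')) <= a + a + (b + b).
  move=> H1 H2 H3 H4; apply: le_trans (ler_cmodB _ _) _.
  by apply: lerD; apply: le_trans (ler_cmodB _ _) _; apply: lerD.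
have := tri _ _ _ _ _ _ (EB (x + w) _) (EB x _) (EA (y + h) _) (EA y _).
(* Each corner value of [Lam] occurs twice with opposite signs, so the affine parts cancel. *)
have -> : forall l1 l2 l3 l4 m1 m2 m3 m4 a1 a2 a3 a4 : R[i],
  (m1 - m2 - (l1 - l2)) - (m3 - m4 - (l3 - l4)) -
  ((a1 - a2 - (l1 - l3)) - (a3 - a4 - (l2 - l4))) =
  (m1 - m2) - (m3 - m4) - ((a1 - a2) - (a3 - a4)) by move=> *; ring.
move=> H; apply: (le_trans (H _ _ _ _)); [lra | lra | lra | lra |].
have -> : e' * (K * s) * K * h + e' * (K * s) * K * h +
   (e' * (K * s) * K * w + e' * (K * s) * K * w) = e' * (2 * K ^+ 2) * s ^+ 2.
  by rewrite /s; ring.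
rewrite ler_wpM2r ?sqr_ge0 // /e' mulrAC ler_pdivrMr; last lra.
by rewrite ler_wpM2l; lra.
Qed.

End Goursat.

(** * Cauchy's formula and Taylor expansions *)

Section CircleIntegral.
Context {R : realType}.
Implicit Types (r : R) (phi psi : R[i] -> R[i]) (t : R[i]).

Definition cis (x : R) : R[i] := (cos x +i* sin x)%C.

Lemma cmod_cis x : cmod (cis x) = 1.
Proof. by rewrite /= cos2Dsin2 sqrtr1. Qed.

Lemma cis0 : cis 0 = 1.
Proof. by rewrite /cis cos0 sin0. Qed.

Lemma cis2pi : cis (pi *+ 2) = 1.
Proof. by rewrite /cis cos2pi sin2pi. Qed.

(** The angle is a complex parameter of which only the real part counts, so that [has_deriv] over a
    segment applies to it. *)
Definition circle r t : R[i] := r%:C%C * cis (Re t).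

Lemma cmod_circle r t : 0 <= r -> cmod (circle r t) = r.
Proof. by move=> r0; rewrite cmodM cmod_cis mulr1 cmodR ger0_norm. Qed.

Lemma circle_neq0 r t : 0 < r -> circle r t != 0.
Proof. by move=> r0; rewrite -cmod_gt0 cmod_circle // ltW. Qed.

Lemma has_deriv_circle a b r t : segment a b t ->
  has_deriv (segment a b) (circle r) t ('i%C * circle r t).
Proof.
move=> ts; rewrite /circle mulrCA; apply: has_derivZ.
have -> : 'i%C * cis (Re t) = (- sin (Re t) +i* cos (Re t))%C.
  by rewrite /cis; apply/eqP; rewrite eq_complex /=; apply/andP; split; apply/eqP; ring.
exact: has_deriv_path.
Qed.

Lemma has_deriv_circleVX a b r k t : 0 < r -> segment a b t ->
  has_deriv (segment a b) (fun s => (circle r s)^-1 ^+ k) t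
    (- ('i%C * k%:R) * (circle r t)^-1 ^+ k).
Proof.
move=> r0 ts; have h1 : has_deriv (segment a b) (fun s => (circle r s)^-1) t
    (- 'i%C * (circle r t)^-1).
  have -> : - 'i%C * (circle r t)^-1 = - ('i%C * circle r t) / circle r t ^+ 2.
    by have := circle_neq0 t r0 => ?; field.
  apply: has_derivV => //; first by move=> s _; exact: circle_neq0.
  exact: has_deriv_circle.
elim: k => [|k IHk].
  rewrite mulr0 oppr0 mul0r; under eq_fun do rewrite expr0.
  exact: has_deriv_cst.
under eq_fun do rewrite exprS.
rewrite (_ : - _ * _ = (- 'i%C * (circle r t)^-1) * (circle r t)^-1 ^+ k +
  (circle r t)^-1 * (- ('i%C * k%:R) * (circle r t)^-1 ^+ k)); last first.
  by rewrite exprS -(addn1 k) natrD; ring.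
exact: has_derivM.
Qed.

Local Notation turn := (segment 0 (pi *+ 2 : R)).

Lemma pi2_ge0 : 0 <= (pi *+ 2 : R).
Proof. by rewrite mulrn_wge0 // pi_ge0. Qed.

Lemma pi2_gt0 : 0 < (pi *+ 2 : R).
Proof. by rewrite pmulrn_lgt0 // pi_gt0. Qed.

Definition turn_continuous phi :=
  forall t, turn t -> phi @ within turn (nbhs t) --> phi t.

Lemma has_deriv_turn_continuous phi :
  (forall t, turn t -> exists d, has_deriv turn phi t d) -> turn_continuous phi.
Proof. by move=> H t /H[d]; exact: has_deriv_cvg. Qed.

Lemma turn_continuousD phi psi : turn_continuous phi -> turn_continuous psi ->
  turn_continuous (fun t => phi t + psi t).
Proof.
move=> phic psic t ts; have := phic t ts; have := psic t ts => h2 h1.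
exact: (@cvgD R[i] R[i] R[i] _ _ phi psi _ _ h1 h2).
Qed.

Lemma turn_continuousM phi psi : turn_continuous phi -> turn_continuous psi ->
  turn_continuous (fun t => phi t * psi t).
Proof.
move=> phic psic t ts; have := phic t ts; have := psic t ts => h2 h1.
exact: (@cvgM R[i] _ _ _ phi psi _ _ h1 h2).
Qed.

Lemma turn_continuous_cst c : turn_continuous (fun=> c).
Proof. by move=> t ts; exact: cvg_cst. Qed.

Lemma turn_continuous_sum I (s : seq I) (phi : I -> R[i] -> R[i]) :
  (forall k, turn_continuous (phi k)) ->
  turn_continuous (fun t => \sum_(k <- s) phi k t).
Proof.
move=> phic; elim: s => [|k s IHs].
  have := @turn_continuous_cst 0.
  by congr turn_continuous; apply/funext => t; rewrite big_nil.
have := turn_continuousD (phic k) IHs.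
by congr turn_continuous; apply/funext => t; rewrite big_cons.
Qed.

(* Equal to [0] when [phi] has no primitive. *)
Definition turn_int phi : R[i] :=
  let P := xget (fun=> 0) [set P | primitive 0 (pi *+ 2) phi P] in
  P (pi *+ 2)%:C%C - P 0%:C%C.

Lemma turn_intE phi P : primitive 0 (pi *+ 2) phi P ->
  turn_int phi = P (pi *+ 2)%:C%C - P 0%:C%C.
Proof.
move=> phiP; rewrite /turn_int; case: xgetP => [Q _ phiQ|/(_ P)//].
exact: primitive_unique pi2_ge0 phiQ phiP.
Qed.

Lemma turn_int_primitive phi : turn_continuous phi ->
  exists2 P, primitive 0 (pi *+ 2) phi P &
    turn_int phi = P (pi *+ 2)%:C%C - P 0%:C%C.
Proof.
move=> /(continuous_has_primitive pi2_ge0)[P phiP]; exists P => //.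
exact: turn_intE.
Qed.

Lemma turn_int_le phi M : turn_continuous phi ->
  (forall t, turn t -> cmod (phi t) <= M) ->
  cmod (turn_int phi) <= M * (pi *+ 2).
Proof.
move=> /turn_int_primitive[P phiP ->] /(primitive_le pi2_ge0 phiP).
by rewrite subr0.
Qed.

Lemma turn_intD phi psi : turn_continuous phi -> turn_continuous psi ->
  turn_int (fun t => phi t + psi t) = turn_int phi + turn_int psi.
Proof.
move=> /turn_int_primitive[P phiP ->] /turn_int_primitive[Q psiQ ->].
rewrite (@turn_intE _ (fun t => P t + Q t)); first by ring.
by move=> t ts; apply: has_derivD; [exact: phiP | exact: psiQ].
Qed.

Lemma turn_intZ c phi : turn_continuous phi ->
  turn_int (fun t => c * phi t) = c * turn_int phi.
Proof.
move=> /turn_int_primitive[P phiP ->].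
rewrite (@turn_intE _ (fun t => c * P t)); first by ring.
by move=> t ts; apply: has_derivZ; exact: phiP.
Qed.

Lemma turn_int_cst c : turn_int (fun=> c) = (pi *+ 2)%:C%C * c.
Proof.
rewrite (@turn_intE _ (fun t => c * t)).
  by rewrite mulr0 subr0 mulrC.
move=> t ts; rewrite -[X in has_deriv _ _ _ X](mulr1 c).
exact: has_derivZ (has_deriv_id _ _).
Qed.

Lemma turn_continuousB phi psi : turn_continuous phi -> turn_continuous psi ->
  turn_continuous (fun t => phi t - psi t).
Proof.
move=> phic psic t ts; have := phic t ts; have := psic t ts => h2 h1.
exact: (@cvgB R[i] R[i] R[i] _ _ phi psi _ _ h1 h2).
Qed.

Lemma turn_intB phi psi : turn_continuous phi -> turn_continuous psi ->
  turn_int (fun t => phi t - psi t) = turn_int phi - turn_int psi.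
Proof.
move=> /turn_int_primitive[P phiP ->] /turn_int_primitive[Q psiQ ->].
rewrite (@turn_intE _ (fun t => P t - Q t)); first by ring.
by move=> t ts; apply: has_derivB; [exact: phiP | exact: psiQ].
Qed.

Lemma turn_int_sum I (s : seq I) (phi : I -> R[i] -> R[i]) :
  (forall k, turn_continuous (phi k)) ->
  turn_int (fun t => \sum_(k <- s) phi k t) = \sum_(k <- s) turn_int (phi k).
Proof.
move=> phic; elim: s => [|k s IHs].
  by under eq_fun do rewrite big_nil; rewrite turn_int_cst mulr0 big_nil.
rewrite big_cons -IHs -(turn_intD (phic k) (@turn_continuous_sum I s phi phic)).
by congr turn_int; apply/funext => t; rewrite big_cons.
Qed.

Lemma turn_continuous_circle r : turn_continuous (circle r).
Proof.
by apply: has_deriv_turn_continuous => t ts; eexists; exact: has_deriv_circle.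
Qed.

Lemma turn_continuous_circleVX r k : 0 < r ->
  turn_continuous (fun t => (circle r t)^-1 ^+ k).
Proof.
move=> r0; apply: has_deriv_turn_continuous => t ts; eexists.
exact: has_deriv_circleVX.
Qed.

Lemma circle_period r : circle r (pi *+ 2)%:C%C = circle r 0%:C%C.
Proof. by rewrite /circle /= cis2pi cis0. Qed.

(** Up to a constant factor this power is its own primitive, and it takes equal values at both ends
    of the turn. *)
Lemma turn_int_circleVX r k : 0 < r ->
  turn_int (fun t => (circle r t)^-1 ^+ k.+1) = 0.
Proof.
move=> r0; rewrite (@turn_intE _
    (fun t => 'i%C / k.+1%:R * (circle r t)^-1 ^+ k.+1)).
  by rewrite circle_period subrr.
move=> t ts; have := has_derivZ ('i%C / k.+1%:R) (has_deriv_circleVX k.+1 r0 ts).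
congr has_deriv; have k0 : k.+1%:R != 0 :> R[i] by rewrite pnatr_eq0.
have i2 : 'i%C * 'i%C = -1 :> R[i] by rewrite -expr2 sqr_i.
rewrite mulrA; rewrite (_ : 'i%C / k.+1%:R * - ('i%C * k.+1%:R) = 1) ?mul1r //.
by rewrite mulrN mulrACA i2 mulVf // mulr1 opprK.
Qed.

End CircleIntegral.

(** * Cauchy's theorem for a difference quotient *)

Section Taylor.
Context {R : realType}.
Implicit Types (f : R[i] -> R[i]) (r rho M : R) (w : R[i]).

Definition disc rho : set R[i] := [set z | cmod z < rho].

Definition holomorphic (D : set R[i]) f :=
  forall z, D z -> exists d, has_deriv D f z d.

Lemma exists_geom_lt (q c e : R) : 0 <= q < 1 -> 0 < e ->
  exists K0, forall K, (K0 <= K)%N -> c * q ^+ K < e.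
Proof.
move=> /andP[q0 q1] e0.
have [c0|c0] := leP c 0.
  by exists 0%N => K _; apply: le_lt_trans e0; rewrite mulr_le0_ge0 ?exprn_ge0.
have /cvgrPdist_lt/(_ (e / c) (divr_gt0 e0 c0))[K0 _ K0P] :
  (fun K => q ^+ K) @ \oo --> (0 : R) by apply: cvg_expr; rewrite ger0_norm.
exists K0 => K /K0P /=; rewrite sub0r normrN ger0_norm ?exprn_ge0 //.
by rewrite ltr_pdivlMr // mulrC.
Qed.

Lemma circle_turn_continuous f rho r : holomorphic (disc rho) f -> 0 <= r < rho ->
  turn_continuous (fun t => f (circle r t)).
Proof.
move=> fh /andP[r0 rrho]; have rD t : disc rho (circle r t).
  by move: rrho; rewrite -{1}(cmod_circle t r0).
apply: has_deriv_turn_continuous => t ts.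
have [d fd] := fh _ (rD t); eexists.
exact: (has_deriv_comp ts (fun s _ => rD s) (has_deriv_circle r ts) fd).
Qed.

(* Contract the circle of radius [r] linearly to [w]. *)
Lemma cauchy_circle f rho r w : holomorphic (disc rho) f ->
  0 < r < rho -> cmod w < r ->
  turn_int (fun t => (f (circle r t) - f w) / (circle r t - w) *
    ('i%C * circle r t)) = 0.
Proof.
move=> fh /andP[r0 rrho] wr.
pose g v := (f v - f w) / (v - w).
(* The quotient [g] is not known to be differentiable at [w], so the homotopy [z] is used for x > 0
   only and the limit x -> 0 is estimated separately at the end. *)
pose D : set R[i] := [set v | disc rho v /\ v != w].
pose z (x y : R) := w + x%:C%C * (circle r y%:C%C - w).
have zetaw t : 0 < cmod (circle r t - w).
  have := ler_cmod_sub (circle r t) w; rewrite cmod_circle ?(ltW r0) //; lra.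
have zw x y : 0 < x -> z x y != w.
  move=> x0; rewrite -subr_eq0 /z (addrC w) addrK mulf_neq0 //.
    by rewrite -cmod_eq0 cmodR gt_eqF // normr_gt0 gt_eqF.
  by rewrite -cmod_gt0.
have gD v : D v -> exists d, has_deriv D g v d.
  move=> [vD vw]; have [d fd] := fh _ vD; eexists.
  have Dv : D v by [].
  have sub : D `<=` disc rho by move=> ? [].
  apply: has_derivM (has_derivB (has_deriv_subset sub fd) (has_deriv_cst _ _ _)) _.
  apply: has_derivV => //; first by move=> u [_]; rewrite subr_eq0.
  exact: has_derivB (has_deriv_id _ _) (has_deriv_cst _ _ _).
have zD x y : 0 < x <= 1 -> D (z x y).
  move=> /andP[x0 x1]; split; last exact: zw.
  have -> : z x y = (1 - x)%:C%C * w + x%:C%C * circle r y%:C%C.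
    by rewrite /z rmorphB /=; ring.
  apply: le_lt_trans rrho; apply: le_trans (ler_cmodD _ _) _.
  rewrite !cmodM !cmodR cmod_cis mulr1 (gtr0_norm x0) (gtr0_norm r0) ger0_norm; nra.
pose zx (x y : R) := circle r y%:C%C - w.
pose zy (x y : R) := x%:C%C * ('i%C * circle r y%:C%C).
have circleRe t : circle r (Re t)%:C%C = circle r t by [].
have zxP x0 y : primitive x0 1 (fun t => zx (Re t) y) (fun t => z (Re t) y).
  move=> t ts; rewrite /zx /z -[X in has_deriv _ _ _ X]add0r.
  apply: has_derivD (has_deriv_cst _ _ _) _.
  have h := has_derivM (has_deriv_id (segment x0 1) t)
    (has_deriv_cst (segment x0 1) (circle r y%:C%C - w) t).
  rewrite mul1r mulr0 addr0 in h.
  by apply: eq_has_deriv h => // s ss; rewrite {1}(segmentE ss).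
have zyP x : primitive 0 (pi *+ 2) (fun t => zy x (Re t)) (fun t => z x (Re t)).
  move=> t ts; rewrite /zy /z -[X in has_deriv _ _ _ X]add0r.
  apply: has_derivD (has_deriv_cst _ _ _) (has_derivZ _ _).
  rewrite -[X in has_deriv _ _ _ X]subr0.
  exact: has_derivB (has_deriv_circle r ts) (has_deriv_cst _ _ _).
have gzc (D' : set R[i]) gam t d : D' t -> (forall s, D' s -> D (gam s)) ->
    has_deriv D' gam t d -> exists d', has_deriv D' (fun s => g (gam s)) t d'.
  move=> D't gamD gamd; have [d' gd] := gD _ (gamD t D't); eexists.
  exact: has_deriv_comp D't gamD gamd gd.
have PBc x : 0 < x <= 1 ->
    turn_continuous (fun t => g (z x (Re t)) * zy x (Re t)).
  move=> x01; apply: turn_continuousM.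
    apply: has_deriv_turn_continuous => t ts.
    exact: (gzc _ (fun t => z x (Re t)) _ _ ts (fun s _ => zD x (Re s) x01) (zyP x t ts)).
  exact: (turn_continuousM (@turn_continuous_cst R x%:C%C)
    (turn_continuousM (@turn_continuous_cst R 'i%C) (@turn_continuous_circle R r))).
have PAex x0 y : 0 < x0 <= 1 ->
    exists P, primitive x0 1 (fun t => g (z (Re t) y) * zx (Re t) y) P.
  move=> /andP[x00 x01]; apply: continuous_has_primitive => // t ts.
  have [|d gd] := gzc _ (fun t => z (Re t) y) t _ ts _ (zxP x0 y t ts).
    by move=> s [_ /andP[s0 s1]]; apply: zD; rewrite s1 andbT; lra.
  apply: has_deriv_cvg; apply: has_derivM gd (has_deriv_cst _ _ _).
(* Goursat's lemma over [x0, 1] x [0, 2 pi]: the sides y = 0 and y = 2 pi have the same image, their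
   contributions cancel, and the integrals at x = x0 and x = 1 agree. *)
have const x0 : 0 < x0 <= 1 ->
    turn_int (fun t => g (z x0 (Re t)) * zy x0 (Re t)) =
    turn_int (fun t => g (z 1 (Re t)) * zy 1 (Re t)).
  move=> /andP[x00 x01].
  pose PA y := xget (fun=> 0) [set P |
    primitive x0 1 (fun t => g (z (Re t) y) * zx (Re t) y) P].
  pose PB x := xget (fun=> 0) [set P |
    primitive 0 (pi *+ 2) (fun t => g (z x (Re t)) * zy x (Re t)) P].
  have PAP y : primitive x0 1 (fun t => g (z (Re t) y) * zx (Re t) y) (PA y).
    rewrite /PA; case: xgetP => [//|]; have [|P PP] := PAex x0 y; first by rewrite x00.
    by move=> /(_ P).
  have PBP x : x0 <= x <= 1 ->
      primitive 0 (pi *+ 2) (fun t => g (z x (Re t)) * zy x (Re t)) (PB x).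
    move=> /andP[xx0 x1]; rewrite /PB; case: xgetP => [//|].
    have [|P PP _] := @turn_int_primitive R _ (PBc x _); first by rewrite x1 andbT; lra.
    by move=> /(_ P).
  clearbody PA PB.
  have := @goursat R D g z zx zy PA PB x0 0 (1 - x0) (pi *+ 2) (2 * r).
  rewrite subrKC add0r subr_ge0 => /(_ x01 pi2_ge0) H.
  have x0x0 : x0 <= x0 <= 1 by rewrite lexx x01.
  have x0x1 : x0 <= (1 : R) <= 1 by rewrite x01 lexx.
  rewrite (turn_intE (PBP x0 x0x0)) (turn_intE (PBP 1 x0x1)).
  apply/esym/eqP; rewrite -subr_eq0 H.
  - have E : (fun t => g (z (Re t) (pi *+ 2)) * zx (Re t) (pi *+ 2)) =
        (fun t => g (z (Re t) 0) * zx (Re t) 0).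
      by apply/funext => t; rewrite /z /zx circle_period.
    have PA2 := PAP (pi *+ 2); rewrite E in PA2.
    have E' := primitive_unique x01 PA2 (PAP 0).
    by rewrite E' subrr.
  - move=> x y /andP[xx0 x1] yh.
    have x01' : 0 < x <= 1 by rewrite x1 andbT; lra.
    have cr := cmod_circle y%:C%C (ltW r0).
    split; [exact: zD | | | by apply: gD; exact: zD].
      by have := ler_cmodB (circle r y%:C%C) w; rewrite cr /zx; lra.
    rewrite !cmodM cmodR -/(circle r _) -cmodM.
    have -> : cmod (r%:C%C * cis (Re y%:C%C)) = r by rewrite -[RHS]cr.
    have -> : cmod ('i%C : R[i]) = 1 by rewrite /= expr0n expr1n add0r sqrtr1.
    rewrite gtr0_norm; nra.
  - by move=> y _; exact: zxP.
  - by move=> x _; exact: zyP.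
  - by move=> y _; exact: PAP.
  - by move=> x /PBP.
have -> : (fun t => (f (circle r t) - f w) / (circle r t - w) * ('i%C * circle r t))
    = (fun t => g (z 1 (Re t)) * zy 1 (Re t)).
  by apply/funext => t; rewrite /g /z /zy circleRe !mul1r subrKC.
apply/eqP; rewrite -cmod_eq0 eq_le cmod_ge0 andbT; apply/ler_addgt0Pr => e e0.
rewrite add0r; have wD : disc rho w by apply: lt_trans rrho.
pose m := r - cmod w; have m0 : 0 < m by rewrite subr_gt0.
(* On the contracted circle the factors [x0] of z - w and of [zy] cancel, leaving an integrand of
   modulus at most e' r / m, where m bounds |zeta - w| from below; over one turn this makes e. *)
pose e' := e * m / (r * (pi *+ 2)).
have e'0 : 0 < e' by rewrite divr_gt0 ?mulr_gt0 // pi2_gt0.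
have [d fd] := fh _ wD.
have [s s0 sP] := (cvg_withinP _ _ _ _).1 (has_deriv_cvg fd) e' e'0.
(* The contracted circle stays within 2 r x0 of [w]; the factor 3 makes this strictly less than
   [s]. *)
pose x0 := Num.min 1 (s / (3 * r)).
have x00 : 0 < x0 by rewrite lt_min ltr01 divr_gt0 ?mulr_gt0.
have x01 : 0 < x0 <= 1 by rewrite x00 ge_min lexx.
have x0s : x0 * (2 * r) < s.
  have : x0 <= s / (3 * r) by rewrite ge_min lexx orbT.
  rewrite ler_pdivlMr ?mulr_gt0 //; have := mulr_gt0 x00 r0; clear; lra.
rewrite -(const x0 x01).
have -> : e = e' * r / m * (pi *+ 2).
  rewrite /e'; have := @pi2_gt0 R; move: (pi *+ 2) (m) m0 => T m' m'0 T0.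
  by field; rewrite !gt_eqF.
apply: turn_int_le; first exact: PBc.
move=> t ts; rewrite /g /zy.
have zwE : z x0 (Re t) - w = x0%:C%C * (circle r t - w).
  by rewrite /z circleRe; ring.
have -> : (f (z x0 (Re t)) - f w) / (z x0 (Re t) - w) *
    (x0%:C%C * ('i%C * circle r (Re t)%:C%C)) =
   (f (z x0 (Re t)) - f w) * ('i%C * circle r t) / (circle r t - w).
  have nz1 : circle r t - w != 0 by rewrite -cmod_gt0.
  have nz2 : x0%:C%C != 0 :> R[i] by rewrite -cmod_gt0 cmodR normr_gt0 gt_eqF.
  by rewrite zwE circleRe; field; rewrite nz1 nz2.
rewrite !cmodM cmodV -cmodM -/(circle r t) cmod_circle ?(ltW r0) //.
have -> : cmod ('i%C : R[i]) = 1 by rewrite /= expr0n expr1n add0r sqrtr1.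
rewrite mul1r; apply: ler_pM.
- by rewrite mulr_ge0 ?cmod_ge0 // ltW.
- by rewrite invr_ge0 ltW.
- rewrite ler_pM2r //; apply/ltW/sP; first by have [] := zD x0 (Re t) x01.
  rewrite zwE cmodM cmodR gtr0_norm //; apply: le_lt_trans x0s.
  rewrite ler_pM2l //; have := ler_cmodB (circle r t) w.
  rewrite cmod_circle ?(ltW r0) //; lra.
- rewrite lef_pV2 ?posrE //; have := ler_cmod_sub (circle r t) w.
  by rewrite cmod_circle ?(ltW r0).
Qed.

End Taylor.

(** * Taylor expansion with remainder, and its coefficients *)

Section TaylorSeries.
Context {R : realType}.
Implicit Types (f : R[i] -> R[i]) (r rho M q : R) (w : R[i]).

(** The geometric series bounds the difference of two partial sums; letting the longer one tend to
    [X] removes the constant [C], which serves only to ensure convergence. *)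
Lemma geometric_tail (X : R[i]) (u : nat -> R[i]) M (C q : R) : 0 <= q < 1 ->
  (forall k, cmod (u k) <= M * q ^+ k) ->
  (forall K, cmod (X - \sum_(k < K.+1) u k) <= C * q ^+ K) ->
  forall K, cmod (X - \sum_(k < K) u k) <= M * q ^+ K / (1 - q).
Proof.
move=> /[dup] q01 /andP[q0 q1] uM XC K; apply/ler_addgt0Pr => e e0.
have q1' : 0 < 1 - q by rewrite subr_gt0.
have M0 : 0 <= M.
  by have := uM 0%N; rewrite expr0 mulr1; apply: le_trans; exact: cmod_ge0.
have part j : cmod (\sum_(k < K + j) u k - \sum_(k < K) u k)
    <= M * q ^+ K * (1 - q ^+ j) / (1 - q).
  elim: j => [|j IHj]; first by rewrite addn0 subrr cmod0 expr0 subrr mulr0 mul0r.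
  rewrite addnS big_ord_recr /= addrAC; apply: le_trans (ler_cmodD _ _) _.
  apply: le_trans (lerD IHj (uM (K + j)%N)) _; rewrite exprD exprS.
  by rewrite le_eqVlt; apply/orP; left; apply/eqP; field; rewrite gt_eqF.
have [K0 K0P] := exists_geom_lt C q01 e0.
have := part K0.+1; rewrite addnS => H1.
have H2 := XC (K + K0)%N; have H3 := K0P (K + K0)%N (leq_addl _ _).
have -> : X - \sum_(k < K) u k = (X - \sum_(k < (K + K0).+1) u k) +
  (\sum_(k < (K + K0).+1) u k - \sum_(k < K) u k) by ring.
apply: le_trans (ler_cmodD _ _) _; rewrite addrC; apply: lerD; last first.
  exact: le_trans H2 (ltW H3).
apply: le_trans H1 _; rewrite ler_pM2r ?invr_gt0 // ler_piMr //.
  by rewrite mulr_ge0 // exprn_ge0.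
by rewrite gerBl exprn_ge0.
Qed.

(** Since d zeta = i zeta dt on the circle, this is the Taylor coefficient at 0: the integral of
    f(zeta) / zeta^(k+1) d zeta divided by 2 pi i. *)
Definition circle_coef f r k : R[i] := ((pi *+ 2)%:C%C)^-1 *
  turn_int (fun t => f (circle r t) * (circle r t)^-1 ^+ k).

Let pi2c_neq0 : (pi *+ 2)%:C%C != 0 :> R[i].
Proof. by rewrite -cmod_gt0 cmodR normr_gt0 gt_eqF // pi2_gt0. Qed.

Let coef_continuous f rho r k : holomorphic (disc rho) f -> 0 < r < rho ->
  turn_continuous (fun t => f (circle r t) * (circle r t)^-1 ^+ k).
Proof.
move=> fh /andP[r0 rrho].
apply: (turn_continuousM (@circle_turn_continuous R f rho r fh _)).
  by rewrite ltW.
exact: (@turn_continuous_circleVX R r k r0).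
Qed.

Lemma circle_coef_le f rho r M k : holomorphic (disc rho) f -> 0 < r < rho ->
  (forall z, cmod z = r -> cmod (f z) <= M) ->
  cmod (circle_coef f r k) <= M / r ^+ k.
Proof.
move=> fh r0rho fM; have /andP[r0 _] := r0rho.
rewrite cmodM cmodV cmodR ger0_norm ?pi2_ge0 // mulrC ler_pdivrMr ?pi2_gt0 //.
apply: turn_int_le; first exact: coef_continuous fh r0rho.
move=> t _; rewrite cmodM cmodX cmodV cmod_circle ?(ltW r0) // exprVn.
by rewrite ler_pM2r ?invr_gt0 ?exprn_gt0 // fM // cmod_circle // ltW.
Qed.

(** Finite geometric expansion of zeta / (zeta - w) in powers of w / zeta; the remainder keeps the
    difference quotient as a factor. *)
Let geometric_split f r w K (t : R[i]) : 0 < r -> cmod w < r ->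
  (f (circle r t) - f w) / (circle r t - w) * circle r t =
  \sum_(k < K) w ^+ k * (f (circle r t) * (circle r t)^-1 ^+ k) +
  \sum_(k < K) (- f w * w ^+ k) * (circle r t)^-1 ^+ k +
  (f (circle r t) - f w) / (circle r t - w) * circle r t *
    (w / circle r t) ^+ K.
Proof.
move=> r0 wr; set c := circle r t; have c0 : c != 0 by exact: circle_neq0.
have cw : c - w != 0.
  rewrite -cmod_gt0; have := ler_cmod_sub c w; rewrite cmod_circle ?(ltW r0) //; lra.
elim: K => [|K IHK]; first by rewrite !big_ord0 expr0; ring.
apply: (etrans IHK); rewrite !big_ord_recr /= !exprMn !exprS.
move: (w ^+ K) (c^-1 ^+ K) => a b.
by field; rewrite c0 cw.
Qed.

(** By Cauchy's theorem the left side of [geometric_split] integrates to 0, and its two sums yield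
    the partial sum and - f w. The remainder is thus geometric, with a crude constant involving |f
    w| and the distance from [w] to the circle; [geometric_tail] replaces it by one obtained from
    Cauchy's estimates. *)
Lemma taylor f rho r M : holomorphic (disc rho) f -> 0 < r < rho ->
  (forall z, cmod z = r -> cmod (f z) <= M) ->
  forall w K, cmod w < r ->
    cmod (f w - \sum_(k < K) circle_coef f r k * w ^+ k) <=
    M * (cmod w / r) ^+ K / (1 - cmod w / r).
Proof.
move=> fh r0rho fM w K wr; have /andP[r0 rrho] := r0rho.
have q01 : 0 <= cmod w / r < 1.
  by rewrite divr_ge0 ?cmod_ge0 ?(ltW r0) //= ltr_pdivrMr // mul1r.
apply: (@geometric_tail (f w) (fun k => circle_coef f r k * w ^+ k) M
  ((M + cmod (f w)) * (r / (r - cmod w))) (cmod w / r)) => //.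
  move=> k; rewrite cmodM cmodX expr_div_n mulrA mulrAC.
  by apply: ler_wpM2r; [rewrite exprn_ge0 ?cmod_ge0 | exact: circle_coef_le fh r0rho fM].
move=> {}K; set q := cmod w / r.
have fc := @circle_turn_continuous R f rho r fh.
have r0' : 0 <= r < rho by rewrite ltW.
have zw t : circle r t - w != 0.
  rewrite -cmod_gt0; have := ler_cmod_sub (circle r t) w.
  rewrite cmod_circle ?(ltW r0) //; lra.
pose h t := (f (circle r t) - f w) / (circle r t - w) * circle r t.
have hc : turn_continuous h.
  apply: turn_continuousM (@turn_continuous_circle R r).
  apply: turn_continuousM.
    exact: (turn_continuousD (fc r0') (@turn_continuous_cst R (- f w))).
  apply: has_deriv_turn_continuous => t ts; eexists.
  apply: has_derivV => //.
  exact: has_derivB (has_deriv_circle r ts) (has_deriv_cst _ _ _).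
have int0 : turn_int h = 0.
  have := cauchy_circle fh r0rho wr.
  have -> : (fun t => (f (circle r t) - f w) / (circle r t - w) * ('i%C * circle r t)) =
    (fun t => 'i%C * h t) by apply/funext => t; rewrite /h mulrCA.
  rewrite turn_intZ // => /eqP; rewrite mulf_eq0.
  by case/orP => [/eqP[] /eqP|/eqP //]; rewrite oner_eq0.
pose u k t := w ^+ k * (f (circle r t) * (circle r t)^-1 ^+ k).
pose v k t := (- f w * w ^+ k) * (circle r t)^-1 ^+ k.
pose e K t := h t * (w * (circle r t)^-1 ^+ 1) ^+ K.
have uc k : turn_continuous (u k).
  exact: (turn_continuousM (@turn_continuous_cst R (w ^+ k))
    (@coef_continuous f rho r k fh r0rho)).
have vc k : turn_continuous (v k).
  exact: (turn_continuousM (@turn_continuous_cst R (- f w * w ^+ k))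
    (@turn_continuous_circleVX R r k r0)).
have ec k : turn_continuous (e k).
  suff pc : turn_continuous (fun t => (w * (circle r t)^-1 ^+ 1) ^+ k).
    exact: (turn_continuousM hc pc).
  elim: k => [|k IHk].
    have := @turn_continuous_cst R 1.
    by congr turn_continuous; apply/funext => t; rewrite expr0.
  have := turn_continuousM (turn_continuousM (@turn_continuous_cst R w)
    (@turn_continuous_circleVX R r 1 r0)) IHk.
  by congr turn_continuous; apply/funext => t; rewrite [RHS]exprS.
have split : h = fun t => \sum_(k < K.+1) u k t + \sum_(k < K.+1) v k t + e K.+1 t.
  by apply/funext => t; rewrite /h (geometric_split f K.+1 t r0 wr).
have uint k : turn_int (u k) = (pi *+ 2)%:C%C * (circle_coef f r k * w ^+ k).
  rewrite turn_intZ; last exact: coef_continuous fh r0rho.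
  by rewrite /circle_coef -mulrA mulVKf // mulrC.
(* Only the constant term survives integration; summing over [K.+1] terms guarantees that it is
   present. *)
have vint k : turn_int (v k) = if k is 0%N then (pi *+ 2)%:C%C * - f w else 0.
  rewrite turn_intZ; last exact: (@turn_continuous_circleVX R r k r0).
  case: k => [|k]; last by rewrite turn_int_circleVX // mulr0.
  under eq_fun do rewrite expr0.
  by rewrite turn_int_cst expr0; ring.
have sint : (pi *+ 2)%:C%C * (f w - \sum_(k < K.+1) circle_coef f r k * w ^+ k) =
    turn_int (e K.+1).
  have uc' := @turn_continuous_sum R _ (index_enum 'I_K.+1) (fun k => u k) (fun k => uc k).
  have vc' := @turn_continuous_sum R _ (index_enum 'I_K.+1) (fun k => v k) (fun k => vc k).
  move: int0; rewrite split (turn_intD (turn_continuousD uc' vc') (ec _)).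
  rewrite (turn_intD uc' vc') (@turn_int_sum R _ _ (fun k : 'I_K.+1 => u k) (fun k => uc k)).
  rewrite (@turn_int_sum R _ _ (fun k : 'I_K.+1 => v k) (fun k => vc k)) => /eqP.
  rewrite addrC addr_eq0 => /eqP eE.
  have Su : \sum_(k < K.+1) turn_int (u k) =
      (pi *+ 2)%:C%C * \sum_(k < K.+1) circle_coef f r k * w ^+ k.
    by rewrite mulr_sumr; apply: eq_bigr => k _; exact: uint.
  have Sv : \sum_(k < K.+1) turn_int (v k) = (pi *+ 2)%:C%C * - f w.
    rewrite big_ord_recl big1; first by rewrite addr0; exact: vint 0%N.
    by move=> k _; exact: vint (lift ord0 k).
  apply: (etrans _ (esym (etrans eE (congr1 -%R (congr2 +%R Su Sv))))).
  by rewrite -mulrDr -mulrN opprD opprK addrC.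
have T0 := @pi2_gt0 R.
have : cmod (turn_int (e K.+1)) <= (M + cmod (f w)) * (r / (r - cmod w)) * q ^+ K * (pi *+ 2).
  apply: turn_int_le; first exact: ec.
  move=> t _; have cr := cmod_circle t (ltW r0).
  have hE : cmod (h t) = cmod (f (circle r t) - f w) * (r / cmod (circle r t - w)).
    by rewrite /h (cmodM (_ / _) (circle r t)) cmodM cmodV cr -mulrA [_^-1 * r]mulrC.
  have -> : cmod (e K.+1 t) = cmod (h t) * q ^+ K.+1.
    by rewrite /e expr1 cmodM cmodX (cmodM w) cmodV cr.
  have /andP[q0 q1] := q01.
  rewrite hE; apply: ler_pM.
  - by rewrite mulr_ge0 ?divr_ge0 ?cmod_ge0 // ltW.
  - by rewrite exprn_ge0.
  - apply: ler_pM; first exact: cmod_ge0.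
    + by rewrite divr_ge0 ?cmod_ge0 // ltW.
    + by apply: le_trans (ler_cmodB _ _) _; rewrite lerD2r; exact: fM.
    rewrite ler_pM2l // lef_pV2 ?posrE ?subr_gt0 ?cmod_gt0 //.
    by have := ler_cmod_sub (circle r t) w; rewrite cr.
  - by rewrite exprS ler_piMl ?exprn_ge0 // ltW.
by rewrite -sint cmodM cmodR gtr0_norm // mulrC ler_pM2r.
Qed.

Lemma circle_coef0 f rho r M : holomorphic (disc rho) f -> 0 < r < rho ->
  (forall z, cmod z = r -> cmod (f z) <= M) -> circle_coef f r 0 = f 0.
Proof.
move=> fh r0rho fM; have /andP[r0 _] := r0rho.
have := taylor fh r0rho fM (w := 0) 1; rewrite cmod0 mul0r mulr0 mul0r => /(_ r0).
rewrite big_ord_recl big_ord0 /= addr0 mulr1 => H.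
by apply/esym/eqP; rewrite -subr_eq0 -cmod_eq0 eq_le cmod_ge0 andbT.
Qed.

(** Both [d] and the coefficient describe the increment of [f] from 0 to a small real [x] to first
    order, so they differ by at most e for every e > 0. *)
Lemma circle_coef1 f rho r M d : holomorphic (disc rho) f -> 0 < r < rho ->
  (forall z, cmod z = r -> cmod (f z) <= M) -> has_deriv (disc rho) f 0 d ->
  circle_coef f r 1 = d.
Proof.
move=> fh r0rho fM; have /andP[r0 rrho] := r0rho.
have D0 : disc rho 0 by rewrite /disc /mkset cmod0; exact: lt_trans rrho.
move=> /(has_derivP _ _ D0) fd.
apply/eqP; rewrite -subr_eq0 -cmod_eq0 eq_le cmod_ge0 andbT.
apply/ler_addgt0Pr => e e0; rewrite add0r.
have M0 : 0 <= M.
  by apply: le_trans (fM r%:C%C _); rewrite ?cmod_ge0 // cmodR gtr0_norm.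
have [s s0 sP] := fd _ (divr_gt0 e0 (ltr0Sn R 1)).
(* In turn: the derivative estimate with tolerance e / 2 applies; x / r <= 1 / 2, so the geometric
   factor is at most 2; and M (x / r)^2 <= e x / 4. *)
pose x := Num.min (Num.min (s / 2) (r / 2)) (e * r ^+ 2 / (4 * (M + 1))).
have x0 : 0 < x.
  by rewrite !lt_min !divr_gt0 ?mulr_gt0 ?exprn_gt0 //; lra.
have xs : x <= s / 2 by rewrite !ge_min lexx.
have xr : x <= r / 2 by rewrite !ge_min lexx orbT.
have xe : x * (4 * (M + 1)) <= e * r ^+ 2.
  by rewrite -ler_pdivlMr ?mulr_gt0 //; [rewrite !ge_min lexx !orbT | lra].
clearbody x; have cx : cmod (x%:C%C : R[i]) = x by rewrite cmodR gtr0_norm.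
have := sP x%:C%C; rewrite !subr0 /disc /mkset cx => H1.
have := taylor fh r0rho fM (w := x%:C%C) 2; rewrite cx.
have -> : \sum_(k < 2) circle_coef f r k * x%:C%C ^+ k =
    f 0 + circle_coef f r 1 * x%:C%C.
  rewrite !big_ord_recl big_ord0 addr0; congr (_ + _).
  by rewrite -(circle_coef0 fh r0rho fM); exact: mulr1.
move=> H2.
have {H1} := H1 ltac:(lra) ltac:(lra) => H1.
have {H2} := H2 ltac:(lra) => H2.
have q2 : x / r <= 1 / 2 by rewrite ler_pdivrMr //; lra.
have H3 : M * (x / r) ^+ 2 / (1 - x / r) <= e / 2 * x.
  have H4 : M * (x / r) ^+ 2 <= e / 4 * x.
    rewrite expr_div_n mulrA ler_pdivrMr ?exprn_gt0 //.
    have := ler_wpM2l (ltW x0) xe; have := mulr_gt0 x0 x0.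
    by rewrite expr2; clear; lra.
  rewrite ler_pdivrMr; last by clear -q2; lra.
  have q2' : 0 <= 1 / 2 - x / r by rewrite subr_ge0.
  have := mulr_ge0 (ltW (mulr_gt0 e0 x0)) q2'; clear -H4.
  by move: (x / r) (M * _) H4 => q A; lra.
have E : (circle_coef f r 1 - d) * x%:C%C = (f x%:C%C - f 0 - d * x%:C%C) -
  (f x%:C%C - (f 0 + circle_coef f r 1 * x%:C%C)) by ring.
rewrite -(ler_pM2r x0) -{1}cx -cmodM E.
apply: le_trans (ler_cmodB _ _) _.
by have := lerD H1 (le_trans H2 H3); lra.
Qed.

(* Integrate the derivative of [f (zeta) / zeta ^ (k + 1)] over one turn. *)
Lemma circle_coef_deriv f f' rho r k : holomorphic (disc rho) f' ->
  (forall z, disc rho z -> has_deriv (disc rho) f z (f' z)) -> 0 < r < rho ->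
  circle_coef f r k.+1 * k.+1%:R = circle_coef f' r k.
Proof.
move=> f'h fd r0rho; have /andP[r0 rrho] := r0rho.
have fh : holomorphic (disc rho) f by move=> z /fd; exists (f' z).
have u_cont := @coef_continuous f rho r k.+1 fh r0rho.
have v_cont := @coef_continuous f' rho r k f'h r0rho.
pose P t := f (circle r t) * (circle r t)^-1 ^+ k.+1.
have rD t : disc rho (circle r t) by rewrite /disc /mkset cmod_circle // ltW.
have PP : primitive 0 (pi *+ 2) (fun t => 'i%C * (f' (circle r t) *
   (circle r t)^-1 ^+ k) + (- ('i%C * k.+1%:R)) * P t) P.
  move=> t ts; have h1 := has_deriv_comp ts (fun s _ => rD s)
    (has_deriv_circle r ts) (fd _ (rD t)).
  have := has_derivM h1 (has_deriv_circleVX k.+1 r0 ts).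
  congr has_deriv; rewrite /P exprS; have := circle_neq0 t r0.
  move: (circle r t) => c c0; move: (c^-1 ^+ k) => a.
  by field.
have := turn_intE PP; rewrite /P circle_period subrr => H.
have uc : turn_continuous (fun t => - ('i%C * k.+1%:R) * P t).
  exact: (turn_continuousM (@turn_continuous_cst R _) u_cont).
have vc : turn_continuous (fun t => 'i%C * (f' (circle r t) * (circle r t)^-1 ^+ k)).
  exact: (turn_continuousM (@turn_continuous_cst R 'i%C) v_cont).
move: H; rewrite (turn_intD vc uc) (turn_intZ _ v_cont) (turn_intZ _ u_cont).
rewrite mulNr => /eqP; rewrite subr_eq0 -mulrA => /eqP H.
have i0 : 'i%C != 0 :> R[i] by rewrite eq_complex /= oner_eq0 andbF.
have {H} := mulfI i0 H => H.
by rewrite /circle_coef H -mulrA [_ * k.+1%:R]mulrC.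
Qed.

End TaylorSeries.

(** * Several complex variables *)

Section EuclideanNorm.
Context {R : realType} {n : nat}.
Implicit Types (u v z : 'rV[R[i]]_n) (t : R[i]).

Lemma enorm_ge0 z : 0 <= enorm z.
Proof. exact: sqrtr_ge0. Qed.

Lemma sqr_enorm z : enorm z ^+ 2 = \sum_(j < n) cmod (z 0 j) ^+ 2.
Proof. by rewrite sqr_sqrtr // sumr_ge0 // => j _; rewrite sqr_ge0. Qed.

Lemma ler_cmod_enorm z j : cmod (z 0 j) <= enorm z.
Proof.
rewrite -(@ler_pXn2r _ 2) ?nnegrE ?cmod_ge0 ?enorm_ge0 // sqr_enorm.
by rewrite (bigD1 j) //= lerDl sumr_ge0 // => i _; rewrite sqr_ge0.
Qed.

(** The sum of the squares of B a_j - C b_j equals B (A B - C^2); if B = 0, all b_j vanish. *)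
Lemma cauchy_schwarz (a b : 'I_n -> R) :
  (\sum_j a j * b j) ^+ 2 <= (\sum_j a j ^+ 2) * (\sum_j b j ^+ 2).
Proof.
set A := \sum_j a j ^+ 2; set B := \sum_j b j ^+ 2; set C := \sum_j a j * b j.
have B0 : 0 <= B by rewrite sumr_ge0 // => j _; rewrite sqr_ge0.
have : 0 <= \sum_j (B * a j - C * b j) ^+ 2.
  by rewrite sumr_ge0 // => j _; rewrite sqr_ge0.
have -> : \sum_j (B * a j - C * b j) ^+ 2 = B * (A * B - C ^+ 2).
  have E x y : \sum_j (x * a j - y * b j) ^+ 2 =
      x ^+ 2 * A - 2 * x * y * C + y ^+ 2 * B.
    rewrite /A /B /C !mulr_sumr -sumrB -big_split /=.
    by apply: eq_bigr => j _; ring.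
  by rewrite E; ring.
have [B1|] := ltP 0 B; first by rewrite pmulr_rge0 // subr_ge0.
move=> B1; have {B1}B1 : B = 0 by apply/eqP; rewrite eq_le B1.
suff -> : C = 0 by rewrite expr0n B1 mulr0.
apply: big1 => j _; have /eqP : b j ^+ 2 = 0.
  by apply: (psumr_eq0P _ B1) => // i _; rewrite sqr_ge0.
by rewrite expf_eq0 => /andP[_ /eqP ->]; rewrite mulr0.
Qed.

Lemma ler_enormD u v : enorm (u + v) <= enorm u + enorm v.
Proof.
rewrite -(@ler_pXn2r _ 2) ?nnegrE ?addr_ge0 ?enorm_ge0 // sqr_enorm sqrrD !sqr_enorm.
set C := \sum_j cmod (u 0 j) * cmod (v 0 j).
have C0 : 0 <= C by rewrite sumr_ge0 // => j _; rewrite mulr_ge0 ?cmod_ge0.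
have CS : C <= enorm u * enorm v.
  rewrite -(@ler_pXn2r _ 2) ?nnegrE ?mulr_ge0 ?enorm_ge0 // exprMn !sqr_enorm.
  exact: cauchy_schwarz.
apply: le_trans (_ : \sum_j (cmod (u 0 j) + cmod (v 0 j)) ^+ 2 <= _).
  apply: ler_sum => j _; rewrite mxE ler_pXn2r ?nnegrE ?addr_ge0 ?cmod_ge0 //.
  exact: ler_cmodD.
under eq_bigr do rewrite sqrrD.
rewrite !big_split /= -addrA -[leRHS]addrA lerD2l lerD2r.
by rewrite mulr2n lerD.
Qed.

Lemma enormZ t z : enorm (t *: z) = cmod t * enorm z.
Proof.
apply/eqP; rewrite -(@eqrXn2 _ 2) ?mulr_ge0 ?cmod_ge0 ?enorm_ge0 //.
rewrite exprMn !sqr_enorm mulr_sumr; apply/eqP/eq_bigr => j _.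
by rewrite mxE cmodM exprMn.
Qed.

Lemma enorm_gt0 z : z != 0 -> 0 < enorm z.
Proof.
rewrite lt_neqAle enorm_ge0 andbT eq_sym; apply: contra => /eqP z0.
apply/eqP/rowP => j; rewrite mxE; apply: esym; apply: ComplexField.Normc.eq0_normc.
by apply/eqP; rewrite eq_le cmod_ge0 andbT z0 ler_cmod_enorm.
Qed.

Lemma enorm0 : enorm (0 : 'rV[R[i]]_n) = 0.
Proof. by rewrite -(scale0r 0) enormZ cmod0 mul0r. Qed.

Lemma enorm_le_coord z (c : R) : 0 <= c -> (forall j, cmod (z 0 j) <= c) ->
  enorm z <= n%:R * c.
Proof.
move=> c0 zc; rewrite -(@ler_pXn2r _ 2) ?nnegrE ?mulr_ge0 ?enorm_ge0 // sqr_enorm.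
apply: le_trans (_ : \sum_(j < n) c ^+ 2 <= _).
  by apply: ler_sum => j _; rewrite ler_pXn2r ?nnegrE ?cmod_ge0.
rewrite sumr_const card_ord exprMn -(mulr_natl (c ^+ 2)) ler_wpM2r ?sqr_ge0 //.
by rewrite -natrX ler_nat; case: (n) => // m; rewrite expnS leq_pmulr.
Qed.

(* The library norm is the sup norm, with values in the complex numbers. *)
Lemma rV_norm_real z : exists2 c, `|z| = c%:C%C &
  [/\ 0 <= c, c <= enorm z & forall j, cmod (z 0 j) <= c].
Proof.
have : 0 <= `|z| by [].
case E : `|z| => [c d]; rewrite lecE /= => /andP[/eqP d0 c0]; subst d.
exists c => //; split => //.
  have [->|c1] := eqVneq c 0; first exact: enorm_ge0.
  have nz0 : mx_norm z != 0.
    by rewrite -[mx_norm z]/`|z| E eq_complex /= eqxx andbT.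
  have [[k j] /=] := mx_norm_neq0 nz0.
  rewrite -[mx_norm z]/`|z| E (ord1 k) cmodE => -[->].
  exact: ler_cmod_enorm.
move=> j; rewrite -lecR -[c%:C%C]/(c +i* 0)%C -E -cmodE.
rewrite -[X in _ <= X]/(mx_norm z) mx_normE -[leLHS]nngE num_le.
exact: (le_bigmax _ (fun k => `|z k.1 k.2|%:nng) (0, j)).
Qed.

End EuclideanNorm.

(** * Complex differentials in terms of the Euclidean norm *)

Section Differential.
Context {R : realType} {n : nat}.
Implicit Types (F : 'rV[R[i]]_n -> R[i]) (z v h b : 'rV[R[i]]_n).

Definition linear_form (c : 'I_n -> R[i]) h : R[i] := \sum_j h 0 j * c j.

Let linear_form_is_linear c : linear (linear_form c).
Proof.
move=> a u v; rewrite /linear_form scaler_sumr -big_split /=.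
by apply: eq_bigr => j _; rewrite !mxE mulrDl -mulrA.
Qed.

HB.instance Definition _ c := GRing.isLinear.Build R[i] 'rV[R[i]]_n R[i] _
  (linear_form c) (linear_form_is_linear c).

Lemma nbhs_enormP z (A : set 'rV[R[i]]_n) :
  nbhs z A <-> exists2 e, 0 < e & forall y, enorm (y - z) < e -> A y.
Proof.
split=> [/nbhs_ballP[_ /= /ltc_real[e e0 ->] sA]|[e e0 sA]].
  exists e => // y yz; apply: sA; rewrite -ball_normE /ball_ /= distrC.
  by have [c -> [c0 cz _]] := rV_norm_real (y - z); rewrite ltcR (le_lt_trans cz).
(* The Euclidean norm is at most n times the sup norm; [n.+1] keeps the quotient positive for n = 0
   as well. *)
apply/nbhs_ballP; have en0 : 0 < e / n.+1%:R by rewrite divr_gt0.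
exists (e / n.+1%:R)%:C%C => /=; first by rewrite ltcR.
move=> y; rewrite -ball_normE /ball_ /= distrC.
have [c -> [c0 cz zc]] := rV_norm_real (y - z); rewrite ltcR => cn.
apply: sA; apply: le_lt_trans (enorm_le_coord c0 zc) _.
rewrite ltr_pdivlMr // mulrC in cn; apply: le_lt_trans cn.
by rewrite ler_wpM2r // ler_nat.
Qed.

Lemma linear_form_le c h :
  cmod (linear_form c h) <= enorm h * \sum_j cmod (c j).
Proof.
apply: le_trans (ler_cmod_sum _ _ _) _; rewrite mulr_sumr.
by apply: ler_sum => j _; rewrite cmodM ler_wpM2r ?cmod_ge0 ?ler_cmod_enorm.
Qed.

Let linear_form_continuous c : continuous (linear_form c).
Proof.
move=> h; apply/(cvgrPdist_lt (F := nbhs h)) => _ /ltc_real[e e0 ->].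
have S0 : 0 <= \sum_j cmod (c j) by rewrite sumr_ge0 // => j _; exact: cmod_ge0.
apply/nbhs_enormP; exists (e / (\sum_j cmod (c j) + 1)).
  by rewrite divr_gt0 //; lra.
move=> y yh; rewrite cmodE ltcR cmodB -linearB.
apply: le_lt_trans (linear_form_le _ _) _.
rewrite ltr_pdivlMr in yh; last lra.
by apply: le_lt_trans yh; rewrite ler_wpM2l ?enorm_ge0 //; lra.
Qed.

Lemma differentiable_enorm_le F z : differentiable F z ->
  forall e, 0 < e -> exists2 r, 0 < r & forall h, enorm h < r ->
    cmod (F (z + h) - F z - 'd F z h) <= e * enorm h.
Proof.
move=> /diff_locally /eqaddoP dF e e0.
have := dF e%:C%C; rewrite ltcR => /(_ e0) /nbhs_enormP[r r0 rP].
exists r => // h hr; have := rP h; rewrite subr0 => /(_ hr).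
rewrite -[(_ - _) h]/(F (h + z) - (F z + 'd F z h)) opprD addrA (addrC h) cmodE.
have [c hc [c0 ch _]] := rV_norm_real h.
rewrite /= hc -rmorphM lecR => /le_trans; apply.
by rewrite ler_wpM2l // ltW.
Qed.

(** The linear form with coordinates [c] is continuous, so by uniqueness of the differential it is
    the differential of [F] at [z]. *)
Lemma enorm_le_differentiable F z (c : 'I_n -> R[i]) :
  (forall e, 0 < e -> exists2 r, 0 < r & forall h, enorm h < r ->
    cmod (F (z + h) - F z - linear_form c h) <= e * enorm h) ->
  differentiable F z.
Proof.
move=> H.
have bound (eps : R[i]) : 0 < eps -> \forall h \near (0 : 'rV[R[i]]_n),
    `|F (h + z) - (F z + linear_form c h)| <= eps * `|h|.
  move=> /ltc_real[e e0 ->].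
  have en0 : 0 < e / n.+1%:R by rewrite divr_gt0.
  have [r r0 rP] := H _ en0.
  apply/nbhs_enormP; exists r => // h; rewrite subr0 => /rP.
  rewrite opprD addrA (addrC h).
  have [d hd [d0 _ /(enorm_le_coord d0) dh]] := rV_norm_real h.
  rewrite cmodE /= hd -rmorphM lecR => /le_trans; apply.
  rewrite mulrAC ler_pdivrMr // -mulrA ler_wpM2l ?(ltW e0) // mulrC.
  by apply: le_trans dh _; rewrite ler_wpM2r // ler_nat.
have lc := @linear_form_continuous c.
have dfE : 'd F z = linear_form c :> ('rV[R[i]]_n -> R[i]).
  by apply: (diff_unique lc); apply/eqaddoP => e e0; exact: bound.
apply/diff_locallyP; rewrite dfE; split => //.
by apply/eqaddoP => e e0; exact: bound.
Qed.

Lemma diff_coord F z h : differentiable F z ->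
  'd F z h = linear_form (fun j => 'd F z 'e_j) h.
Proof.
move=> dF; rewrite {1}(row_sum_delta h) linear_sum; apply: eq_bigr => j _.
by rewrite linearZ.
Qed.

Lemma dirderE b F z : differentiable F z -> dirder b F z = 'd F z b.
Proof.
move=> dF; rewrite (diff_coord b dF); apply: eq_bigr => j _.
by rewrite deriveE // mulrC.
Qed.

End Differential.

Lemma taylor_order1 {R : realType} (f : R[i] -> R[i]) (rho r M : R) (d w : R[i]) :
  holomorphic (disc rho) f -> 0 < r < rho ->
  (forall z, cmod z = r -> cmod (f z) <= M) -> has_deriv (disc rho) f 0 d ->
  cmod w < r ->
  cmod (f w - (f 0 + d * w)) <= M * (cmod w / r) ^+ 2 / (1 - cmod w / r).
Proof.
move=> fh r0rho fM fd wr; have := taylor fh r0rho fM 2 wr.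
rewrite -(circle_coef1 fh r0rho fM fd) -(circle_coef0 fh r0rho fM).
have -> // : \sum_(k < 2) circle_coef f r k * w ^+ k =
  circle_coef f r 0 + circle_coef f r 1 * w.
by rewrite !big_ord_recl big_ord0 addr0; congr (_ + _); exact: mulr1.
Qed.

(** Closure under uniform limits, needed for an integrand that is known only as a limit of
    difference quotients. *)
Lemma turn_continuous_lim {R : realType} (phi : R[i] -> R[i]) :
  (forall e, 0 < e -> exists2 psi, turn_continuous psi &
     forall t, segment 0 (pi *+ 2) t -> cmod (phi t - psi t) <= e) ->
  turn_continuous phi.
Proof.
move=> H t ts; apply/cvg_withinP => e e0.
have e4 : 0 < e / 4 by rewrite divr_gt0.
have [psi psic phipsi] := H _ e4.
have [r r0 rP] := (cvg_withinP _ _ _ _).1 (psic t ts) _ e4.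
exists r => // y ys yt.
have -> : phi y - phi t = (phi y - psi y) + (psi y - psi t) - (phi t - psi t) by ring.
have := ler_cmodB ((phi y - psi y) + (psi y - psi t)) (phi t - psi t).
have := ler_cmodD (phi y - psi y) (psi y - psi t).
have := phipsi y ys; have := phipsi t ts; have := rP y ys yt.
move: (cmod _) (cmod _) (cmod _) (cmod _) (cmod _) => *; lra.
Qed.

(** * Analyticity of directional derivatives *)

Section Analytic.
Context {R : realType} {n : nat}.
Implicit Types (F : 'rV[R[i]]_n -> R[i]) (z v h b p : 'rV[R[i]]_n) (t : R[i]).

Lemma slice_has_deriv F (D : set R[i]) z v t : D t ->
  differentiable F (z + t *: v) ->
  has_deriv D (fun s => F (z + s *: v)) t ('d F (z + t *: v) v).
Proof.
move=> Dt dF; apply/has_derivP => // e e0.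
have v1 : 0 < enorm v + 1 by have := enorm_ge0 v; lra.
have [r r0 rP] := differentiable_enorm_le dF (divr_gt0 e0 v1).
exists (r / (enorm v + 1)); first by rewrite divr_gt0.
move=> s _ st; have hE : enorm ((s - t) *: v) <= cmod (s - t) * (enorm v + 1).
  by rewrite enormZ ler_wpM2l ?cmod_ge0 //; lra.
have := rP ((s - t) *: v); rewrite linearZ /=.
have -> : z + t *: v + (s - t) *: v = z + s *: v.
  by rewrite -addrA -scalerDl subrKC.
have -> : (s - t) *: 'd F (z + t *: v) v = 'd F (z + t *: v) v * (s - t).
  by rewrite mulrC.
move=> H; apply: le_trans (H _) _.
  by apply: le_lt_trans hE _; rewrite -ltr_pdivlMr.
rewrite mulrAC ler_pdivrMr // -mulrA; apply: ler_wpM2l hE; exact: ltW.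
Qed.

Lemma unit_ballD z h : enorm h < 1 - enorm z -> unit_ball R n (z + h).
Proof.
move=> hz; rewrite /unit_ball /=; apply: le_lt_trans (ler_enormD _ _) _; lra.
Qed.

(** The first-order estimate at [z] with tolerance 1 already bounds [F] nearby; Cauchy's estimates
    on slices ask for no more. *)
Lemma analytic_locally_bounded F z : analytic_in_ball F -> unit_ball R n z ->
  exists r M, [/\ 0 < r, 0 <= M & forall h, enorm h < r ->
    unit_ball R n (z + h) /\ cmod (F (z + h)) <= M].
Proof.
move=> Fa zb; have [r r0 rP] := differentiable_enorm_le (Fa z zb) (ltr01 : 0 < (1 : R)).
have zb' : 0 < 1 - enorm z by rewrite subr_gt0.
set S := \sum_j cmod ('d F z 'e_j).
have S0 : 0 <= S by rewrite sumr_ge0 // => j _; exact: cmod_ge0.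
have F0 := cmod_ge0 (F z).
exists (Num.min r (1 - enorm z)), (cmod (F z) + r * S + r); split.
- by rewrite lt_min r0.
- by have := mulr_ge0 (ltW r0) S0; lra.
move=> h; rewrite lt_min => /andP[hr hz]; split; first exact: unit_ballD.
have H1 := rP h hr; rewrite mul1r in H1.
have H2 : cmod ('d F z h) <= r * S.
  rewrite (diff_coord h (Fa z zb)); apply: le_trans (linear_form_le _ _) _.
  by rewrite ler_wpM2r // ltW.
have -> : F (z + h) = (F (z + h) - F z - 'd F z h) + 'd F z h + F z by ring.
apply: le_trans (ler_cmodD _ _) _; have := ler_cmodD (F (z + h) - F z - 'd F z h) ('d F z h).
move: H1 H2 F0; move: (cmod _) (cmod _) (cmod _) => A B C; lra.
Qed.

Section LocalBound.
Variables (F : 'rV[R[i]]_n -> R[i]) (z : 'rV[R[i]]_n) (r M : R).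
Hypotheses (r0 : 0 < r) (M0 : 0 <= M).
Hypothesis Fdiff : forall h, enorm h < r -> differentiable F (z + h).
Hypothesis FM : forall h, enorm h < r -> cmod (F (z + h)) <= M.

(** With r1 = r / (4 |v|) >= 2, the Taylor remainder in [second_order] is at most 2 M / r1^2 = 32 M
    |v|^2 / r^2; the constant is not sharp. *)
Let C := 128 * M / r ^+ 2.

Let C_ge0 : 0 <= C.
Proof. by apply: divr_ge0; [apply: mulr_ge0 | exact: sqr_ge0]. Qed.

Lemma slice_holomorphic h v (rho : R) : enorm h + rho * enorm v <= r -> v != 0 ->
  holomorphic (disc rho) (fun s => F (z + h + s *: v)).
Proof.
move=> hr v0 t Dt; eexists; apply: slice_has_deriv => //.
rewrite -addrA; apply: Fdiff; apply: le_lt_trans (ler_enormD _ _) _.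
apply: lt_le_trans hr; rewrite enormZ ltrD2l ltr_pM2r //.
exact: enorm_gt0.
Qed.

(** First-order Taylor formula for s -> F (z + h + s v), taken at s = 1 with a circle of radius [r1]
    such that r1 |v| = r / 4. The point is uniformity: the constant depends neither on [h] nor on
    the direction of [v]. *)
Lemma second_order h v : enorm h <= r / 2 -> enorm v <= r / 8 ->
  cmod (F (z + h + v) - F (z + h) - 'd F (z + h) v) <= C * enorm v ^+ 2.
Proof.
move=> hr vr; have [->|v0] := eqVneq v 0.
  by rewrite addr0 subrr linear0 subrr cmod0 enorm0 expr0n mulr0.
have ev0 := enorm_gt0 v0; set ev := enorm v in ev0 vr *.
pose r1 := r / (4 * ev); pose rho := r / (2 * ev).
have r10 : 0 < r1 by rewrite divr_gt0 ?mulr_gt0.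
have r1E : r1 * ev = r / 4 by rewrite /r1; field; rewrite gt_eqF.
have rhoE : rho * ev = r / 2 by rewrite /rho; field; rewrite gt_eqF.
have r1rho : 0 < r1 < rho.
  by rewrite r10 -(ltr_pM2r ev0) r1E rhoE; lra.
have r12 : 2 <= r1 by rewrite /r1 ler_pdivlMr ?mulr_gt0 //; lra.
have fh : holomorphic (disc rho) (fun s => F (z + h + s *: v)).
  by apply: slice_holomorphic => //; rewrite rhoE; lra.
have D0 : disc rho (0 : R[i]).
  by rewrite /disc /mkset cmod0; move/andP: r1rho => [? ?]; lra.
have fd : has_deriv (disc rho) (fun s => F (z + h + s *: v)) 0 ('d F (z + h) v).
  have := @slice_has_deriv F _ (z + h) v 0 D0; rewrite scale0r addr0; apply.
  by apply: Fdiff; lra.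
have fM s : cmod s = r1 -> cmod (F (z + h + s *: v)) <= M.
  move=> sr1; rewrite -addrA; apply: FM; apply: le_lt_trans (ler_enormD _ _) _.
  by rewrite enormZ sr1 r1E; lra.
have := taylor_order1 (w := 1) fh r1rho fM fd.
rewrite cmod1 scale1r scale0r addr0 mulr1 opprD addrA div1r => H.
apply: le_trans (H _) _; first lra.
have Hr1 : r1^-1 <= 1 / 2 by rewrite div1r lef_pV2 ?posrE.
have -> : C * ev ^+ 2 = 8 * (M * r1^-1 ^+ 2).
  by rewrite /C /r1; field; rewrite !gt_eqF.
rewrite ler_pdivrMr; last lra.
have : 0 <= M * r1^-1 ^+ 2 by rewrite mulr_ge0 ?sqr_ge0.
move: Hr1; set A := M * r1^-1 ^+ 2; move: A => A; move: r1^-1 => q.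
rewrite -subr_ge0 => q2 A0; have := mulr_ge0 A0 q2; lra.
Qed.


(** The differential of [F] is not known to depend continuously on the point. On the circle it is,
    by [second_order], a uniform limit of difference quotients with step [s], and these are
    continuous. *)
Lemma diff_turn_continuous (rho : R) b v : 0 < rho -> rho * enorm b < r / 2 ->
  turn_continuous (fun t => 'd F (z + circle rho t *: b) v).
Proof.
have r_gt0 : 0 < r := r0.
move=> rho0 rhob; apply: turn_continuous_lim => e e0.
have ev := enorm_ge0 v; have Cge0 := C_ge0.
have ct t : enorm (circle rho t *: b) = rho * enorm b.
  by rewrite enormZ cmod_circle // ltW.
(* The first bound makes [second_order] applicable to s v, the second brings the error C s |v|^2
   below [e]. *)
pose s := Num.min (r / 8 / (enorm v + 1)) (e / (C * enorm v ^+ 2 + 1)).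
have v2 : 0 <= C * enorm v ^+ 2 by rewrite mulr_ge0 ?sqr_ge0.
have s0 : 0 < s by rewrite lt_min !divr_gt0 //; lra.
have sv : enorm (s%:C%C *: v) <= r / 8.
  rewrite enormZ cmodR gtr0_norm //.
  have : s * (enorm v + 1) <= r / 8.
    by rewrite -ler_pdivlMr ?ge_min ?lexx //; lra.
  by nra.
have se : s * (C * enorm v ^+ 2) <= e.
  have : s * (C * enorm v ^+ 2 + 1) <= e.
    by rewrite -ler_pdivlMr ?ge_min ?lexx ?orbT //; lra.
  by nra.
exists (fun t => s%:C%C^-1 * (F (z + circle rho t *: b + s%:C%C *: v) -
   F (z + circle rho t *: b))).
  have slice_cont u : enorm u <= r / 8 ->
      turn_continuous (fun t => F (z + circle rho t *: b + u)).
    move=> ur; apply: has_deriv_turn_continuous => t ts; eexists.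
    have -> : (fun t => F (z + circle rho t *: b + u)) =
       fun t => F (z + u + circle rho t *: b).
      by apply/funext => t'; rewrite addrAC.
    apply: (has_deriv_comp (E := setT) (f := fun s => F (z + u + s *: b)) ts _
      (has_deriv_circle rho ts)) => //.
    apply: slice_has_deriv => //; rewrite -addrA; apply: Fdiff.
    by apply: le_lt_trans (ler_enormD _ _) _; rewrite ct; lra.
  have h1 := slice_cont _ sv.
  have h2 : turn_continuous (fun t => F (z + circle rho t *: b)).
    have r8 : enorm (0 : 'rV[R[i]]_n) <= r / 8 by rewrite enorm0; lra.
    have := slice_cont 0 r8.
    by congr turn_continuous; apply/funext => t; rewrite addr0.
  exact: (turn_continuousM (@turn_continuous_cst R (s%:C%C^-1)) (turn_continuousB h1 h2)).
move=> t _; have sc0 : s%:C%C != 0 :> R[i].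
  by rewrite -cmod_gt0 cmodR normr_gt0 gt_eqF.
have H : cmod (F (z + circle rho t *: b + s%:C%C *: v) - F (z + circle rho t *: b) -
    'd F (z + circle rho t *: b) (s%:C%C *: v)) <= C * enorm (s%:C%C *: v) ^+ 2.
  by apply: second_order => //; rewrite ct ltW.
move: H; rewrite linearZ enormZ cmodR gtr0_norm // => H.
rewrite -(ler_pM2l s0) -{1}(gtr0_norm s0) -cmodR -cmodM.
set A := F _ in H *; set B := F _ in H *; set dv := 'd F _ _ in H *.
have -> : s%:C%C * (dv - s%:C%C^-1 * (A - B)) = - (A - B - s%:C%C * dv) by field.
rewrite cmodN; apply: le_trans H _; rewrite exprMn expr2 -mulrA mulrCA ler_pM2l //.
by rewrite mulrCA.
Qed.

(** The radius does not depend on [h]: the derivatives at all points near [z] become integrals over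
    one and the same parameter circle, ready for differentiation under the integral sign. *)
Lemma dirder_circle_coef b (rho : R) h : 0 < rho -> b != 0 -> 2 * rho * enorm b <= r / 2 ->
  enorm h < r / 2 ->
  dirder b F (z + h) = circle_coef (fun s => F (z + h + s *: b)) rho 1.
Proof.
have r_gt0 : 0 < r := r0.
move=> rho0 b0 rhob hr.
rewrite dirderE; last by apply: Fdiff; lra.
have fh : holomorphic (disc (2 * rho)) (fun s => F (z + h + s *: b)).
  by apply: slice_holomorphic => //; lra.
have rho2 : 0 < rho < 2 * rho by lra.
symmetry; apply: (circle_coef1 (M := M) fh rho2).
  move=> s sr; rewrite -addrA; apply: FM; apply: le_lt_trans (ler_enormD _ _) _.
  by rewrite enormZ sr; have := enorm_ge0 b; nra.
have D0 : disc (2 * rho) (0 : R[i]) by rewrite /disc /mkset cmod0; lra.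
have := @slice_has_deriv F _ (z + h) b 0 D0; rewrite scale0r addr0; apply.
by apply: Fdiff; lra.
Qed.

(* Differentiate the Cauchy integral for the derivative along [b] under the
   integral sign; the second-order remainder is uniform on the circle. *)
Lemma dirder_differentiable b : b != 0 -> differentiable (dirder b F) z.
Proof.
have r_gt0 : 0 < r := r0.
move=> b0; have eb := enorm_gt0 b0.
pose rho := r / (16 * enorm b).
have rho0 : 0 < rho by rewrite divr_gt0 ?mulr_gt0.
have rhoE : rho * enorm b = r / 16 by rewrite /rho; field; rewrite gt_eqF.
have ct t : enorm (circle rho t *: b) = rho * enorm b.
  by rewrite enormZ cmod_circle // ltW.
pose T phi := (pi *+ 2)%:C%C^-1 * turn_int (fun t => phi t * (circle rho t)^-1 ^+ 1).
(* The expected partial derivatives of [dirder b F] at [z]: those of [F], put under the Cauchy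
   integral. *)
pose c (j : 'I_n) := T (fun t => 'd F (z + circle rho t *: b) 'e_j).
have Cge0 := C_ge0.
have cV := @turn_continuous_circleVX R rho 1 rho0.
have dc v : turn_continuous (fun t => 'd F (z + circle rho t *: b) v).
  by apply: diff_turn_continuous => //; lra.
have Fc h : enorm h <= r / 8 -> turn_continuous (fun t => F (z + h + circle rho t *: b)).
  move=> hr; apply: has_deriv_turn_continuous => t ts; eexists.
  apply: (has_deriv_comp (E := setT) (f := fun s => F (z + h + s *: b)) ts _
      (has_deriv_circle rho ts)) => //.
  apply: slice_has_deriv => //; rewrite -addrA; apply: Fdiff.
  by apply: le_lt_trans (ler_enormD _ _) _; rewrite ct; lra.
have key h : enorm h <= r / 8 -> cmod (dirder b F (z + h) - dirder b F z -
    linear_form c h) <= C / rho * enorm h ^+ 2.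
  move=> hr; rewrite (@dirder_circle_coef b rho h) //; [|lra|lra].
  rewrite -[in dirder b F z](addr0 z) (@dirder_circle_coef b rho 0) //; [|lra|];
    last by rewrite enorm0; lra.
  have r8 : enorm (0 : 'rV[R[i]]_n) <= r / 8 by rewrite enorm0; lra.
  pose Z t := (circle rho t)^-1 ^+ 1.
  pose u h' t := F (z + h' + circle rho t *: b) * Z t.
  pose d v t := 'd F (z + circle rho t *: b) v * Z t.
  have uc h' : enorm h' <= r / 8 -> turn_continuous (u h').
    by move=> hr'; exact: (turn_continuousM (Fc h' hr') cV).
  have dc' v : turn_continuous (d v) by exact: (turn_continuousM (dc v) cV).
  have hdc j : turn_continuous (fun t => h 0 j * d 'e_j t).
    exact: (turn_continuousM (@turn_continuous_cst R (h 0 j)) (dc' 'e_j)).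
  (* The differential is linear in [h], so its coordinate expansion can be integrated term by
     term. *)
  have lfE : linear_form c h = (pi *+ 2)%:C%C^-1 * turn_int (d h).
    have -> : d h = fun t => \sum_j h 0 j * d 'e_j t.
      apply/funext => t; rewrite /d diff_coord; last by apply: Fdiff; rewrite ct; lra.
      by rewrite mulr_suml; apply: eq_bigr => j _; rewrite mulrA.
    rewrite (@turn_int_sum R _ _ (fun j t => h 0 j * d 'e_j t) hdc) mulr_sumr.
    apply: eq_bigr => j _.
    by rewrite (turn_intZ _ (dc' 'e_j)) mulrCA.
  pose e t := u h t - u 0 t - d h t.
  have sumc := turn_continuousB (uc h hr) (uc 0 r8).
  have ec : turn_continuous e := turn_continuousB sumc (dc' h).
  have Ee : turn_int e = turn_int (u h) - turn_int (u 0) - turn_int (d h) :=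
    etrans (turn_intB sumc (dc' h))
      (congr1 (+%R^~ _) (turn_intB (uc h hr) (uc 0 r8))).
  have -> : circle_coef (fun s => F (z + h + s *: b)) rho 1 -
      circle_coef (fun s => F (z + 0 + s *: b)) rho 1 - linear_form c h =
      (pi *+ 2)%:C%C^-1 * turn_int e.
    apply: esym; apply: (etrans (congr1 ( *%R _) Ee)).
    by rewrite lfE 2!mulrBr; exact: erefl.
  rewrite cmodM cmodV cmodR (gtr0_norm (@pi2_gt0 R)) mulrC.
  rewrite ler_pdivrMr; last exact: pi2_gt0.
  apply: turn_int_le; first exact: ec.
  move=> t _; rewrite /e /u /d -!mulrBl cmodM /Z expr1 cmodV.
  rewrite cmod_circle ?(ltW rho0) // mulrAC ler_pM2r ?invr_gt0 //.
  rewrite addr0 (addrAC z h); apply: second_order => //.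
  by rewrite ct; lra.
apply: (@enorm_le_differentiable _ _ _ _ c) => e e0.
have Cr : 0 <= C / rho by rewrite divr_ge0 // ltW.
exists (Num.min (r / 8) (e / (C / rho + 1))).
  by rewrite lt_min !divr_gt0 //; lra.
move=> h; rewrite lt_min => /andP[/ltW h8]; rewrite ltr_pdivlMr; last lra.
move=> he; apply: le_trans (key h h8) _; rewrite expr2 mulrA.
rewrite ler_wpM2r ?enorm_ge0 // mulrC; apply: le_trans (ltW he).
by rewrite ler_wpM2l ?enorm_ge0 //; lra.
Qed.

End LocalBound.

Lemma dirder_analytic b F : b != 0 -> analytic_in_ball F ->
  analytic_in_ball (dirder b F).
Proof.
move=> b0 Fa z zb; have [r [M [r0 M0 rP]]] := analytic_locally_bounded Fa zb.
apply: (@dirder_differentiable F z r M) => //.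
  by move=> h /rP[? _]; exact: Fa.
by move=> h /rP[].
Qed.

Lemma dirdern_analytic b F k : b != 0 -> analytic_in_ball F ->
  analytic_in_ball (dirdern b k F).
Proof. by move=> b0 Fa; elim: k => // k IHk; exact: dirder_analytic. Qed.

End Analytic.

(** * Functions of bounded index *)

(** Compactness of the square of side 2 r: near a point of the open disc continuity bounds [f], and
    a small rectangle around any other point misses the closed disc of radius [r]. *)
Lemma holomorphic_bounded {R : realType} (f : R[i] -> R[i]) (rho r : R) :
  holomorphic (disc rho) f -> 0 <= r < rho ->
  exists M, forall z, cmod z <= r -> cmod (f z) <= M.
Proof.
move=> fh /andP[r0 rrho].
pose P (x y w h : R) := exists M, forall z, x <= Re z <= x + w -> y <= Im z <= y + h ->
  cmod z <= r -> cmod (f z) <= M.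
have [||||M MP] := @quarter_ind R P (- r) (- r) (2 * r) (2 * r).
- by rewrite mulr_ge0.
- by rewrite mulr_ge0.
- move=> x y w h [M1 H1] [M2 H2] [M3 H3] [M4 H4].
  exists (Num.max (Num.max M1 M2) (Num.max M3 M4)) => z zx zy zr.
  rewrite !le_max; case: (leP (Re z) (x + w)) => rez; case: (leP (Im z) (y + h)) => imz.
  + by rewrite H1 //; lra.
  + by rewrite (H3 z) ?orbT //; lra.
  + by rewrite (H2 z) ?orbT //; lra.
  + by rewrite (H4 z) ?orbT //; lra.
- move=> p q _ _; set c := (p +i* q)%C.
  have near d x y w h z : x <= p <= x + w -> y <= q <= y + h -> w < d / 2 -> h < d / 2 ->
      x <= Re z <= x + w -> y <= Im z <= y + h -> cmod (z - c) < d.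
    move=> px qy wd hd zx zy; have -> : z - c = (Re z - p)%:C%C + 'i%C * (Im z - q)%:C%C.
      by rewrite {1}(complexE z) /c; apply/eqP; rewrite eq_complex /=; apply/andP;
        split; apply/eqP; ring.
    apply: le_lt_trans (ler_cmodD _ _) _; rewrite cmodM !cmodR.
    have -> : cmod ('i%C : R[i]) = 1 by rewrite /= expr0n expr1n add0r sqrtr1.
    have : `|Re z - p| <= w by rewrite ler_norml; lra.
    have : `|Im z - q| <= h by rewrite ler_norml; lra.
    by lra.
  have [crho|rhoc] := ltP (cmod c) rho; last first.
    exists ((rho - r) / 2); first by lra.
    move=> x y w h _ _ _ _ px qy wd hd; exists 0 => z zx zy zr.
    have := near _ _ _ _ _ _ px qy wd hd zx zy.
    have := ler_cmod_sub c (c - z); rewrite subKr (cmodB c z); lra.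
  have [d fd] := fh _ crho.
  have [s s0 sP] := (cvg_withinP _ _ _ _).1 (has_deriv_cvg fd) 1 ltr01.
  exists (s / 2); first by lra.
  move=> x y w h _ _ _ _ px qy wd hd; exists (cmod (f c) + 1) => z zx zy zr.
  have := sP z (le_lt_trans zr rrho) (near _ _ _ _ _ _ px qy wd hd zx zy).
  have := ler_cmodD (f z - f c) (f c); rewrite subrK; lra.
exists M => z zr; have := ler_Re_cmod z; have := ler_Re_cmod (z * 'i%C).
have -> : cmod (z * 'i%C) = cmod z.
  by rewrite cmodM /= expr0n expr1n add0r sqrtr1 mulr1.
rewrite ReiNIm normrN !ler_norml => imz rez.
by apply: MP => //; lra.
Qed.

(** Decay by 1/5 per index makes the terms below [k] sum to at most B / 4, where B = |c_k|, and
    likewise those above; hence [X] is within B / 2 of c_k. *)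
Lemma dominant_term {R : realType} (c : nat -> R[i]) (X : R[i]) (k : nat) (M q : R) :
  0 <= q < 1 ->
  (forall K, cmod (X - \sum_(j < K) c j) <= M * q ^+ K) ->
  (forall j, cmod (c (k + j)%N) <= cmod (c k) / 5 ^+ j) ->
  (forall j, (j <= k)%N -> cmod (c (k - j)%N) <= cmod (c k) / 5 ^+ j) ->
  cmod (c k) / 2 <= cmod X <= 3 * (cmod (c k) / 2).
Proof.
move=> q01 XM up down; set B := cmod (c k).
have B0 : 0 <= B by exact: cmod_ge0.
(* In this form the induction closes exactly, because 1 / 4 = (1 / 4 + 1) / 5. *)
have low m : (m <= k)%N -> cmod (\sum_(j < m) c j) <= B / 4 / 5 ^+ (k - m).
  elim: m => [_|m IHm mk].
    by rewrite big_ord0 cmod0 !divr_ge0 // exprn_ge0.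
  rewrite big_ord_recr /=; apply: le_trans (ler_cmodD _ _) _.
  have := down (k - m)%N (leq_subr _ _); rewrite (subKn (ltnW mk)) => down_m.
  apply: le_trans (lerD (IHm (ltnW mk)) down_m) _.
  rewrite -(subnSK mk) exprS -/B le_eqVlt; apply/orP; left; apply/eqP.
  have : 5 ^+ (k - m.+1) != 0 :> R by rewrite expf_neq0.
  by move: (5 ^+ _) => p p0; field.
have high m : cmod (\sum_(j < k.+1 + m) c j - \sum_(j < k.+1) c j) <=
    B / 4 * (1 - 1 / 5 ^+ m).
  elim: m => [|m IHm]; first by rewrite addn0 subrr cmod0 expr0 divr1 subrr mulr0.
  rewrite addnS big_ord_recr /= addrAC; apply: le_trans (ler_cmodD _ _) _.
  have := up m.+1; rewrite addnS -addSn => up_m.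
  apply: le_trans (lerD IHm up_m) _.
  rewrite exprS -/B le_eqVlt; apply/orP; left; apply/eqP.
  by field; rewrite expf_neq0.
have key : cmod (X - c k) <= B / 2.
  apply/ler_addgt0Pr => e e0; have [K0 K0P] := exists_geom_lt M q01 e0.
  have H1 := XM (k.+1 + K0)%N; have H2 := K0P (k.+1 + K0)%N (leq_addl _ _).
  have H3 := high K0; have H4 := low k (leqnn k).
  have pos5 : 0 <= 1 / 5 ^+ K0 :> R by rewrite divr_ge0 // exprn_ge0.
  rewrite subnn expr0 divr1 in H4.
  have E : X - c k = (X - \sum_(j < k.+1 + K0) c j) +
     (\sum_(j < k.+1 + K0) c j - \sum_(j < k.+1) c j) + \sum_(j < k) c j.
    by rewrite [\sum_(j < k.+1) _]big_ord_recr /=; ring.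
  rewrite E; apply: le_trans (ler_cmodD _ _) _.
  have H5 := ler_cmodD (X - \sum_(j < k.+1 + K0) c j)
    (\sum_(j < k.+1 + K0) c j - \sum_(j < k.+1) c j).
  have H6 : B / 4 * (1 - 1 / 5 ^+ K0) <= B / 4.
    by have := mulr_ge0 B0 pos5; lra.
  by lra.
have := ler_cmod_sub (c k) (c k - X); rewrite subKr (cmodB (c k)) -/B.
have := ler_cmodD (X - c k) (c k); rewrite subrK -/B.
by lra.
Qed.

(** * Restriction to complex lines *)

Section Slices.
Context {R : realType} {n : nat}.
Variables (F : 'rV[R[i]]_n -> R[i]) (b w : 'rV[R[i]]_n).
Hypotheses (b0 : b != 0) (Fa : analytic_in_ball F).

Let rho := (1 - enorm w) / enorm b.

Lemma unit_ball_slice t : disc rho t -> unit_ball R n (w + t *: b).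
Proof.
move=> tr; apply: unit_ballD; rewrite enormZ -ltr_pdivlMr //; exact: enorm_gt0.
Qed.

Lemma dirdern_has_deriv k t : disc rho t ->
  has_deriv (disc rho) (fun s => dirdern b k F (w + s *: b)) t
    (dirdern b k.+1 F (w + t *: b)).
Proof.
move=> tr; have da := dirdern_analytic k b0 Fa (unit_ball_slice tr).
rewrite -[dirdern b k.+1 F _]/(dirder b (dirdern b k F) _) dirderE //.
exact: slice_has_deriv.
Qed.

Lemma dirdern_holomorphic k :
  holomorphic (disc rho) (fun s => dirdern b k F (w + s *: b)).
Proof. by move=> t /(dirdern_has_deriv k); eexists; eassumption. Qed.

(** Each use of [circle_coef_deriv] trades one index of the coefficient for one more derivative,
    until [circle_coef0] evaluates at the centre. In particular the coefficient is the same for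
    every radius. *)
Lemma circle_coef_dirdern r k j : 0 < r < rho ->
  circle_coef (fun s => dirdern b j F (w + s *: b)) r k * k`!%:R =
  dirdern b (j + k) F w.
Proof.
move=> rrho; elim: k j => [|k IHk] j.
  have rrho' : 0 <= r < rho by move: rrho => /andP[/ltW -> ->].
  have [M MP] := holomorphic_bounded (dirdern_holomorphic j) rrho'.
  rewrite (circle_coef0 (dirdern_holomorphic j) rrho (M := M)); last first.
    by move=> z zr; apply: MP; rewrite zr.
  by rewrite scale0r addr0 addn0 mulr1.
rewrite factS natrM mulrA.
rewrite (circle_coef_deriv k (dirdern_holomorphic j.+1) (dirdern_has_deriv j) rrho).
by rewrite IHk addSnnS.
Qed.

Lemma index_term_circle_coef (L : 'rV[R[i]]_n -> R) r k : 0 < r < rho -> 0 < L w ->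
  index_term b L F w k =
  cmod (circle_coef (fun s => F (w + s *: b)) r k) / L w ^+ k.
Proof.
move=> rrho L0; rewrite /index_term -[dirdern b k F w](circle_coef_dirdern k 0 rrho).
rewrite cmodM cmod_nat; by field; rewrite expf_neq0 ?gt_eqF.
Qed.

End Slices.

(** * From bounded index to the condition on circles *)

Section Circles.
Context {R : realType} {n : nat}.
Implicit Types (F : 'rV[R[i]]_n -> R[i]) (L : 'rV[R[i]]_n -> R) (b z w : 'rV[R[i]]_n).

(** This is what the lower bound on [L] in [class_Q] is for: circles of radius up to beta / L w lie
    in the disc on which the slice function is holomorphic. *)
Lemma class_Q_radius b (beta : R) L w : 0 < beta -> b != 0 -> class_Q b beta L ->
  unit_ball R n w -> 0 < beta / L w < (1 - enorm w) / enorm b.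
Proof.
move=> beta0 b0 [_ Lpos Lbeta _] wb; have L0 := Lpos _ wb.
have eb := enorm_gt0 b0; have w1 : 0 < 1 - enorm w by rewrite subr_gt0.
rewrite divr_gt0 //= ltr_pdivrMr // mulrAC ltr_pdivlMr // -ltr_pdivrMl //.
by rewrite mulrC; exact: Lbeta.
Qed.

Lemma slice_shift F b z (t0 t : R[i]) :
  F (z + t *: b) = F (z + t0 *: b + (t - t0) *: b).
Proof. by rewrite -addrA -scalerDl subrKC. Qed.

Lemma circle_values_neq0 F b z (t0 : R[i]) (rho : R) : 0 <= rho ->
  circle_values b F z t0 rho !=set0.
Proof.
move=> rho0; eexists; exists (t0 + rho%:C%C) => //=.
by rewrite addrC addKr cmodR ger0_norm.
Qed.

Lemma circle_max_le_min F b z (t0 : R[i]) (rho m P : R) : 0 <= rho -> 0 <= P ->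
  (forall t, cmod (t - t0) = rho -> m <= cmod (F (z + t *: b)) <= P * m) ->
  circle_max b F z t0 rho <= P * circle_min b F z t0 rho.
Proof.
move=> rho0 P0 H; have ne := circle_values_neq0 F b z t0 rho0.
apply: le_trans (_ : P * m <= _).
  by apply: ge_sup => // _ [t /= tr <-]; have /andP[] := H t tr.
apply: ler_wpM2l => //; apply: lb_le_inf => // _ [t /= tr <-].
by have /andP[] := H t tr.
Qed.

Lemma index_term_ge0 L F b w k : 0 < L w -> 0 <= index_term b L F w k.
Proof. by move=> L0; rewrite divr_ge0 ?cmod_ge0 // mulr_ge0 // exprn_ge0 // ltW. Qed.

(** Maximality at the larger radius controls the terms above [k], maximality at the smaller one
    those below; at [r], a factor 5 away from both, every step away from [k] gains a factor 5. *)
Lemma dominant_between (alpha : nat -> R) (r1 r r2 : R) k :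
  (forall j, 0 <= alpha j) -> 0 < r1 -> 5 * r1 <= r -> 5 * r <= r2 ->
  (forall j, alpha j * r1 ^+ j <= alpha k * r1 ^+ k) ->
  (forall j, alpha j * r2 ^+ j <= alpha k * r2 ^+ k) ->
  (forall j, alpha (k + j)%N * r ^+ (k + j) <= alpha k * r ^+ k / 5 ^+ j) /\
  (forall j, (j <= k)%N ->
     alpha (k - j)%N * r ^+ (k - j) <= alpha k * r ^+ k / 5 ^+ j).
Proof.
move=> a0 r10 r1r rr2 d1 d2; have r0 : 0 < r by lra.
have r20 : 0 < r2 by lra.
have pow_le (x y : R) j : 0 < x -> 5 * x <= y -> x ^+ j * 5 ^+ j <= y ^+ j.
  by move=> x0 xy; rewrite -exprMn; apply: lerXn2r; rewrite ?nnegrE; lra.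
have up j : alpha (k + j)%N * r ^+ (k + j) <= alpha k * r ^+ k / 5 ^+ j.
  have H : alpha (k + j)%N * r2 ^+ j <= alpha k.
    by have := d2 (k + j)%N; rewrite exprD mulrCA mulrC ler_pM2r ?exprn_gt0.
  rewrite ler_pdivlMr ?exprn_gt0 // exprD mulrCA -mulrA mulrC ler_pM2r ?exprn_gt0 //.
  by apply: le_trans H; rewrite -mulrA ler_wpM2l // pow_le.
have down l j : k = (l + j)%N -> alpha l * r ^+ l <= alpha k * r ^+ k / 5 ^+ j.
  move=> kE; have H : alpha l <= alpha k * r1 ^+ j.
    have := d1 l; rewrite [in r1 ^+ k]kE exprD mulrCA [leRHS]mulrC.
    by rewrite ler_pM2r ?exprn_gt0.
  rewrite ler_pdivlMr ?exprn_gt0 // [in r ^+ k]kE exprD mulrAC [leRHS]mulrCA.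
  rewrite [leRHS]mulrC ler_pM2r ?exprn_gt0 //.
  apply: le_trans (ler_wpM2r _ H) _; first by rewrite exprn_ge0.
  by rewrite -mulrA ler_wpM2l // pow_le.
by split=> // j jk; apply: down; rewrite subnK.
Qed.

Lemma bounded_index_circles F L b (beta : R) : 1 < beta -> b != 0 ->
  class_Q b beta L -> analytic_in_ball F -> bounded_L_index b L F ->
  forall rho : R, 0 < rho <= beta ->
  exists P2 eta : R, [/\ 1 <= P2, 0 < eta < rho &
    forall z0 (t0 : R[i]), unit_ball R n z0 -> slice b z0 t0 ->
      exists2 r : R, eta <= r <= rho &
        circle_max b F z0 t0 (r / L (z0 + t0 *: b)) <=
          P2 * circle_min b F z0 t0 (r / L (z0 + t0 *: b))].
Proof.
move=> beta1 b0 LQ Fa [N HN] rho /andP[rho0 rhobeta].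
have beta0 : 0 < beta by lra.
(* For radii at most 1 the powers decrease with the exponent, which [gP] uses to reach indices
   beyond [N]; [rho] is the upper limit for the final radius. *)
pose R0 := Num.min rho 1; pose rad i := R0 / 25 ^+ i.
have R00 : 0 < R0 by rewrite lt_min rho0 ltr01.
have rad0 i : 0 < rad i by rewrite divr_gt0 // exprn_gt0.
have radS i : rad i = 25 * rad i.+1 by rewrite /rad exprS; field; rewrite expf_neq0.
have rad_le i j : (i <= j)%N -> rad j <= rad i.
  move=> ij; rewrite ler_pM2l // lef_pV2 ?posrE ?exprn_gt0 //.
  by rewrite ler_weXn2l //; lra.
have radE0 : rad 0%N = R0 by rewrite /rad expr0 divr1.
have R0rho : R0 <= rho by rewrite ge_min lexx.
have R01 : R0 <= 1 by rewrite ge_min lexx orbT.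
(* 3 = (3 / 2) / (1 / 2) comes from [dominant_term]; [eta] is the smallest of the N + 2 radii. *)
exists 3, (rad N.+1); split.
- by lra.
- rewrite rad0 /=; have := radS N; have := rad_le 0%N N (leq0n _).
  by have := rad0 N.+1; rewrite radE0; lra.
move=> z0 t0 _; rewrite /slice /mkset; set w := z0 + t0 *: b => wb.
have [_ Lpos _ _] := LQ; have L0 := Lpos _ wb.
pose alpha j := index_term b L F w j.
have a0 j : 0 <= alpha j by exact: index_term_ge0.
pose g (i : 'I_N.+2) : 'I_N.+1 := [arg max_(k > ord0) (alpha k * rad i ^+ k)]%O.
have gN (i : 'I_N.+2) (j : 'I_N.+1) :
    alpha j * rad i ^+ j <= alpha (g i) * rad i ^+ g i.
  by rewrite /g; case: Order.TotalTheory.arg_maxP => // k _ /(_ j); exact.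
(* For j > N the power is at most the N-th, the index bound passes to some l <= N, and lowering the
   exponent from N to l only increases the power. *)
have gP (i : 'I_N.+2) j : alpha j * rad i ^+ j <= alpha (g i) * rad i ^+ g i.
  have rad1 : rad i <= 1.
    by have := rad_le 0%N i (leq0n _); rewrite radE0; lra.
  case: (ltnP j N.+1) => jN; first exact: (gN i (Ordinal jN)).
  have NN : rad i ^+ j <= rad i ^+ N.
    by apply: ler_wiXn2l; [exact: ltW | | exact: ltnW].
  apply: le_trans (_ : alpha j * rad i ^+ N <= _); first by rewrite ler_wpM2l.
  rewrite -ler_pdivlMr ?exprn_gt0 //; apply: le_trans (HN j w wb) _.
  rewrite big_mkord; apply/bigmax_leP; split=> [|l _].
    by apply: divr_ge0; [apply: mulr_ge0 => //|]; rewrite exprn_ge0 // ltW.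
  rewrite ler_pdivlMr ?exprn_gt0 //; apply: le_trans (gN i l).
  rewrite ler_wpM2l //; by apply: ler_wiXn2l; [exact: ltW | | rewrite -ltnS].
have [i [j [ij gij]]] : exists i j : 'I_N.+2, (i < j)%N /\ g i = g j.
  have /injectivePn[i [j ij gij]] : ~~ injectiveb g.
    apply/injectiveP => /leq_card; rewrite !card_ord ltnn //.
  case: (ltngtP i j) => [lij|lji|/val_inj eij].
  - by exists i, j.
  - by exists j, i.
  - by rewrite eij eqxx in ij.
(* Five times above [rad j] and, because i < j, at least five times below [rad i]. *)
pose k : nat := g i; pose r := 5 * rad j.
have r0 : 0 < r by rewrite mulr_gt0.
have rj : 5 * r <= rad i.
  rewrite /r mulrA; have := rad_le i.+1 j ij; have := radS i; lra.
have [up down] := dominant_between (k := k) a0 (rad0 j) (lexx r) rj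
  ltac:(by move=> l; rewrite /k gij; exact: gP) (gP i).
have ri : rad i <= R0 by rewrite -radE0; exact: rad_le.
exists r.
  apply/andP; split; last by lra.
  have := rad_le j N.+1 (leq_ord j); have := rad0 j; rewrite /r; lra.
apply: (@circle_max_le_min _ _ _ _ _ (alpha k * r ^+ k / 2)) => //.
  by rewrite divr_ge0 // ltW.
move=> t tr; rewrite (slice_shift F b z0 t0) -/w; set s := t - t0 in tr *.
have betaL := class_Q_radius beta0 b0 LQ wb.
have fh := @dirdern_holomorphic R n F b w b0 Fa 0.
have betaL' : 0 <= beta / L w < (1 - enorm w) / enorm b.
  by case/andP: betaL => [/ltW -> ->].
have [M MP] := holomorphic_bounded fh betaL'.
(* The expansion is taken on the circle of radius beta / L w, of which |s| = r / L w is the fraction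
   r / beta < 1. *)
pose c l := circle_coef (fun s => F (w + s *: b)) (beta / L w) l * s ^+ l.
have cE l : cmod (c l) = alpha l * r ^+ l.
  rewrite /alpha (index_term_circle_coef b0 Fa _ betaL L0) cmodM cmodX tr.
  by rewrite expr_div_n mulrAC mulrA.
have sq : cmod s / (beta / L w) = r / beta by rewrite tr; field; rewrite !gt_eqF.
have q01 : 0 <= r / beta < 1.
  by rewrite divr_ge0 ?(ltW r0) ?(ltW beta0) //= ltr_pdivrMr //; lra.
have sr : cmod s < beta / L w by rewrite tr ltr_pM2r ?invr_gt0 //; lra.
have conv K : cmod (F (w + s *: b) - \sum_(l < K) c l) <=
    M / (1 - r / beta) * (r / beta) ^+ K.
  have := taylor fh betaL (M := M) _ K sr; rewrite sq => H.
  by rewrite mulrAC; apply: H => z zr; apply: MP; rewrite zr.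
have := @dominant_term R c _ k _ _ q01 conv; rewrite !cE; apply.
  by move=> l; rewrite cE; exact: up.
by move=> l lk; rewrite cE; exact: down.
Qed.

End Circles.

(** * From the condition on circles to bounded index *)

Section Propagation.
Context {R : realType} {n : nat}.
Implicit Types (F : 'rV[R[i]]_n -> R[i]) (L : 'rV[R[i]]_n -> R) (b z w : 'rV[R[i]]_n).

(** The case eta = beta, t0 = 0 of the definition; the inequalities between [lambda1], [lambda2], 0
    and infinity make both of them real numbers. *)
Lemma class_Q_ratio b (beta : R) L : 0 < beta -> class_Q b beta L ->
  exists l1 l2 : R, [/\ 0 < l1, 0 < l2 & forall w t, unit_ball R n w ->
    cmod t <= beta / L w -> l1 * L w <= L (w + t *: b) <= l2 * L w].
Proof.
move=> beta0 [_ Lpos _ /(_ beta)]; rewrite lexx (ltW beta0) => /(_ isT)[].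
case E1 : lambda1 => [l1| |] //; case E2 : lambda2 => [l2| |] //.
rewrite lte_fin lee_fin => l10 l12 _; exists l1, l2; split => //.
  exact: lt_le_trans l12.
move=> w t wb tb; have L0 := Lpos _ wb.
have ratio : L_ratios b L beta (L (w + t *: b) / L w)%:E.
  by exists w, 0, t; rewrite /slice /mkset scale0r addr0 subr0.
rewrite -ler_pdivlMr // -[X in _ && X]ler_pdivrMr // -!lee_fin -E1 -E2.
by rewrite ereal_inf_lbound // ereal_sup_ubound.
Qed.

(** The supremum is an upper bound only once the values are known to be bounded, which holomorphy on
    a larger disc provides. *)
Lemma circle_max_min_le F b z (t0 : R[i]) (rho rho' P : R) :
  holomorphic (disc rho') (fun s => F (z + t0 *: b + s *: b)) ->
  0 <= rho < rho' -> 0 <= P ->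
  circle_max b F z t0 rho <= P * circle_min b F z t0 rho ->
  forall t t' : R[i], cmod (t - t0) = rho -> cmod (t' - t0) = rho ->
    cmod (F (z + t *: b)) <= P * cmod (F (z + t' *: b)).
Proof.
move=> Fh rr P0 maxmin t t' tr t'r; have [M MP] := holomorphic_bounded Fh rr.
apply: le_trans (_ : circle_max b F z t0 rho <= _).
  apply: ub_le_sup; last by exists t.
  exists M => _ [s /= sr <-]; rewrite (slice_shift F b z t0).
  by apply: MP; rewrite sr.
apply: le_trans maxmin _; apply: ler_wpM2l => //.
apply: ge_inf; last by exists t'.
by exists 0 => _ [s _ <-]; exact: cmod_ge0.
Qed.

(* A small circle around a point of modulus [x / L w] meets the disc of radius
   [x / L w], so the bound there passes to the circle, then inside it. *)
Lemma propagate F L b (beta l1 l2 P eta : R) w (x x' A : R) :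
  0 < beta -> b != 0 -> class_Q b beta L -> analytic_in_ball F ->
  0 < l1 -> 0 < l2 -> 1 <= P -> 0 < eta ->
  (forall t, cmod t <= beta / L w -> l1 * L w <= L (w + t *: b) <= l2 * L w) ->
  (forall t, slice b w t ->
    exists2 r : R, eta <= r <= Num.min beta (l1 / 2) &
      circle_max b F w t (r / L (w + t *: b)) <=
        P * circle_min b F w t (r / L (w + t *: b))) ->
  unit_ball R n w -> 1 / 2 <= x <= x' -> x' <= beta -> x' <= x + eta / (2 * l2) ->
  (forall t, cmod t <= x / L w -> cmod (F (w + t *: b)) <= A) ->
  forall t, cmod t <= x' / L w -> cmod (F (w + t *: b)) <= 2 * P * A.
Proof.
move=> beta0 b0 LQ Fa l10 l20 P1 eta0 ratio circles wb /andP[x2 xx'] x'beta x'x FA u ux'.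
have [_ Lpos _ _] := LQ; have Lw := Lpos _ wb.
have x0 : 0 < x by lra.
have xL : 0 < x / L w by rewrite divr_gt0.
have A0 : 0 <= A by apply: le_trans (FA 0 _); rewrite ?cmod_ge0 // cmod0 ltW.
have P0 : 0 <= P by lra.
have [ux|xu] := leP (cmod u) (x / L w).
  by apply: le_trans (FA u ux) _; rewrite ler_peMl //; lra.
have u0 : 0 < cmod u by apply: lt_trans xu.
(* Radial projection of [u] onto the circle of radius x / L w: the centre of the small circle. *)
pose v : R[i] := (x / L w / cmod u)%:C%C * u.
have vx : cmod v = x / L w.
  by rewrite cmodM cmodR gtr0_norm ?divr_gt0 // divfK // gt_eqF.
have uv : cmod (u - v) = cmod u - x / L w.
  have -> : u - v = (1 - x / L w / cmod u)%:C%C * u.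
    by rewrite rmorphB /= mulrBl mul1r.
  rewrite cmodM cmodR ger0_norm ?mulrBl ?mul1r ?divfK ?gt_eqF //.
  by rewrite subr_ge0 ler_pdivrMr // mul1r ltW.
clearbody v.
have vbeta : cmod v <= beta / L w.
  by rewrite vx ler_pM2r ?invr_gt0 //; lra.
have /andP[Lv1 Lv2] := ratio v vbeta.
have radw := class_Q_radius beta0 b0 LQ wb.
have vb : unit_ball R n (w + v *: b).
  apply: (unit_ball_slice b0); apply: le_lt_trans vbeta _.
  by case/andP: radw.
have Lv := Lpos _ vb; have [r /andP[er]] := circles v vb.
rewrite le_min => /andP[rbeta rl1] maxmin.
have r0 : 0 < r by lra.
have rL : 0 < r / L (w + v *: b) by rewrite divr_gt0.
(* From r <= l1 / 2 and x >= 1 / 2: the radius is at most r / (l1 L w) <= 1 / (2 L w) <= x / L w. *)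
have rx : r / L (w + v *: b) <= x / L w.
  rewrite ler_pdivrMr // mulrAC ler_pdivlMr //.
  have := ler_wpM2l (ltW x0) Lv1; have := ler_wpM2r (ltW Lw) rl1.
  by have := ler_wpM2r (ltW (mulr_gt0 l10 Lw)) x2; lra.
have radv := class_Q_radius beta0 b0 LQ vb.
have rrho : 0 < r / L (w + v *: b) < (1 - enorm (w + v *: b)) / enorm b.
  rewrite rL /=; case/andP: radv => _; apply: le_lt_trans.
  by rewrite ler_pM2r ?invr_gt0.
have rrho' : 0 <= r / L (w + v *: b) < (1 - enorm (w + v *: b)) / enorm b.
  by case/andP: rrho => /ltW -> ->.
have fh := @dirdern_holomorphic R n F b (w + v *: b) b0 Fa 0.
pose q := (r / L (w + v *: b)) / (x / L w).
have q01 : 0 < q <= 1.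
  by rewrite divr_gt0 //= ler_pdivrMr // mul1r.
(* The point (1 - q) v lies on the small circle and, being on the segment from 0 to [v], also in the
   disc where [A] bounds [F]. *)
have v1v : cmod ((1 - q)%:C%C * v - v) = r / L (w + v *: b).
  have -> : (1 - q)%:C%C * v - v = - (q%:C%C * v) by rewrite rmorphB /=; ring.
  rewrite cmodN cmodM cmodR gtr0_norm; last by case/andP: q01.
  by rewrite vx /q divfK // gt_eqF.
have Fv1 : cmod (F (w + ((1 - q)%:C%C * v) *: b)) <= A.
  apply: FA; rewrite cmodM cmodR vx ger0_norm; last lra.
  by rewrite ler_piMl ?(ltW xL) //; lra.
have onc s : cmod s = r / L (w + v *: b) -> cmod (F (w + v *: b + s *: b)) <= P * A.
  move=> sr; have := circle_max_min_le fh rrho' P0 maxmin (t := v + s) _ v1v.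
  rewrite (addrC v s) addrK => /(_ sr).
  rewrite (addrC s v) scalerDl addrA => /le_trans; apply.
  by rewrite ler_wpM2l.
(* The increment eta / (2 l2) is made for this: [u] lies within half the radius of the small circle,
   whichever r >= eta was supplied. *)
have su : cmod (u - v) <= r / L (w + v *: b) / 2.
  have H1 : cmod (u - v) <= eta / (l2 * L w) / 2.
    rewrite uv; apply: le_trans (_ : x' / L w - x / L w <= _); first by rewrite lerD2r.
    rewrite -mulrBl ler_pdivrMr //.
    have -> : eta / (l2 * L w) / 2 * L w = eta / (2 * l2) by field; rewrite !gt_eqF.
    by lra.
  apply: le_trans H1 _; rewrite ler_pM2r ?invr_gt0 //.
  apply: le_trans (_ : r / (l2 * L w) <= _).
    by rewrite ler_pM2r ?invr_gt0 ?mulr_gt0.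
  by rewrite ler_pM2l // lef_pV2 ?posrE ?mulr_gt0.
have su' : cmod (u - v) < r / L (w + v *: b) by lra.
(* With no terms [taylor] is a weak maximum principle; at half the radius it loses the factor 1 / (1
   - 1 / 2) = 2. *)
have := taylor fh rrho onc 0 su'.
rewrite big_ord0 subr0 expr0 mulr1 (slice_shift F b w v u) => /le_trans; apply.
have q2 : cmod (u - v) / (r / L (w + v *: b)) <= 1 / 2.
  by rewrite ler_pdivrMr //; lra.
rewrite ler_pdivrMr; last lra.
have PA0 : 0 <= P * A by rewrite mulr_ge0.
by rewrite -mulrA mulrAC ler_peMl //; lra.
Qed.

Lemma circles_bounded_index F L b (beta : R) : 1 < beta -> b != 0 ->
  class_Q b beta L -> analytic_in_ball F ->
  (forall rho : R, 0 < rho <= beta ->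
    exists P2 eta : R, [/\ 1 <= P2, 0 < eta < rho &
      forall z0 (t0 : R[i]), unit_ball R n z0 -> slice b z0 t0 ->
        exists2 r : R, eta <= r <= rho &
          circle_max b F z0 t0 (r / L (z0 + t0 *: b)) <=
            P2 * circle_min b F z0 t0 (r / L (z0 + t0 *: b))]) ->
  bounded_L_index b L F.
Proof.
move=> beta1 b0 LQ Fa H; have beta0 : 0 < beta by lra.
have [l1 [l2 [l10 l20 ratio]]] := class_Q_ratio beta0 LQ.
have [|P [eta [P1 /andP[eta0 _] circles]]] := H (Num.min beta (l1 / 2)).
  by rewrite lt_min beta0 divr_gt0 //= ge_min lexx.
pose eta' := eta / (2 * l2).
have eta'0 : 0 < eta' by rewrite divr_gt0 ?mulr_gt0.
(* Enough steps of length [eta'] to lead from 1 / 2 to beta, the same number for all centres. *)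
pose n0 := Num.bound (beta / eta').
have n0P : beta <= eta' * n0%:R.
  rewrite mulrC -ler_pdivrMr //; apply/ltW/archi_boundP.
  by rewrite divr_ge0 ?ltW.
pose Q := (2 * P) ^+ n0.
have Q0 : 0 <= Q by rewrite exprn_ge0 //; lra.
have q01 : 0 <= 1 / beta < 1.
  by rewrite divr_ge0 ?(ltW beta0) //= ltr_pdivrMr // mul1r.
(* [N] is fixed before [w]: it depends on [Q] and [beta] alone. *)
have [N NP] := exists_geom_lt (2 * Q) q01 (ltac:(lra) : 0 < 1 / 2 :> R).
exists N => m w wb; have [_ Lpos _ _] := LQ; have Lw := Lpos _ wb.
set A := \big[Num.max/0]_(0 <= k < N.+1) index_term b L F w k.
have A0 : 0 <= A by rewrite /A big_mkord; exact: bigmax_ge_id.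
pose alpha k := index_term b L F w k.
have a0 k : 0 <= alpha k by exact: index_term_ge0.
have aA k : (k <= N)%N -> alpha k <= A.
  move=> kN; rewrite /A big_mkord.
  exact: (le_bigmax 0 (fun i : 'I_N.+1 => alpha i) (Ordinal (kN : (k < N.+1)%N))).
have betaL := class_Q_radius beta0 b0 LQ wb.
have betaL0 : 0 < beta / L w by case/andP: betaL.
have betaL' : 0 <= beta / L w < (1 - enorm w) / enorm b.
  by case/andP: betaL => [/ltW -> ->].
have fh := @dirdern_holomorphic R n F b w b0 Fa 0.
pose c l := circle_coef (fun s => F (w + s *: b)) (beta / L w) l.
have cE k : cmod (c k) = alpha k * L w ^+ k.
  by rewrite /alpha (index_term_circle_coef b0 Fa _ betaL Lw) divfK // expf_neq0 // gt_eqF.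
have coef_bound M : (forall t, cmod t <= beta / L w -> cmod (F (w + t *: b)) <= M) ->
    forall k, alpha k <= M * (1 / beta) ^+ k.
  move=> MP k; have := circle_coef_le k fh betaL (M := M).
  rewrite -/(c k) cE => H1; rewrite -(ler_pM2r (exprn_gt0 k Lw)).
  apply: le_trans (H1 _) _; first by move=> z zr; apply: MP; rewrite zr.
  rewrite -mulrA -exprMn -exprVn invf_div.
  by rewrite (_ : 1 / beta * L w = L w / beta) // div1r mulrC.
have [M MP] := holomorphic_bounded fh betaL'.
have M0 : 0 <= M by apply: le_trans (MP 0 _); rewrite ?cmod_ge0 // cmod0 ltW.
have aM k : alpha k <= M.
  apply: le_trans (coef_bound M MP k) _; rewrite ler_piMr // exprn_ile1 //.
    by case/andP: q01.
  by case/andP: q01 => _ /ltW.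
(* The bound [M] depends on [w], but it is used only to make this supremum finite and to ensure
   convergence. *)
pose S := sup (range alpha).
have aS k : alpha k <= S.
  by apply: ub_le_sup; [exists M => _ [j _ <-]; exact: aM | exists k].
have S0 : 0 <= S := le_trans (a0 0%N) (aS 0%N).
(* On this disc the k-th term of the expansion is at most S / 2^k, so the sum is at most 2 S. *)
have inner t : cmod t <= 1 / 2 / L w -> cmod (F (w + t *: b)) <= 2 * S.
  move=> t2; have tq : cmod t / (beta / L w) <= 1 / 2.
    rewrite ler_pdivrMr //; apply: le_trans t2 _.
    by rewrite mulrA ler_pM2r ?invr_gt0 //; lra.
  have tr : cmod t < beta / L w.
    by apply: le_lt_trans t2 _; rewrite ltr_pM2r ?invr_gt0 //; lra.
  have tq0 : 0 <= cmod t / (beta / L w) by rewrite divr_ge0 ?cmod_ge0 // ltW.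
  have half : 0 <= (1 / 2 : R) < 1 by lra.
  have term_le k : cmod (c k * t ^+ k) <= S * (1 / 2) ^+ k.
    rewrite cmodM cmodX cE -mulrA -exprMn; apply: ler_pM => //.
      by rewrite exprn_ge0 // mulr_ge0 ?cmod_ge0 // ltW.
    apply: lerXn2r; rewrite ?nnegrE ?mulr_ge0 ?cmod_ge0 ?(ltW Lw) //.
    by rewrite mulrC -ler_pdivlMr.
  have conv K : cmod (F (w + t *: b) - \sum_(k < K.+1) c k * t ^+ k) <=
      2 * M * (1 / 2) ^+ K.
    apply: le_trans (taylor fh betaL (M := M) _ K.+1 tr) _.
      by move=> z zr; apply: MP; rewrite zr.
    have pw : (cmod t / (beta / L w)) ^+ K.+1 <= (1 / 2) ^+ K.
      rewrite exprS; apply: le_trans (_ : 1 * (cmod t / (beta / L w)) ^+ K <= _).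
        by rewrite ler_wpM2r ?exprn_ge0 //; lra.
      by rewrite mul1r; apply: lerXn2r; rewrite ?nnegrE.
    rewrite ler_pdivrMr; last lra.
    apply: le_trans (ler_wpM2l M0 pw) _; rewrite -[2 * M * _]mulrA mulrAC ler_peMl //.
      by rewrite mulr_ge0 // exprn_ge0.
    lra.
  have := geometric_tail half term_le conv 0%N.
  rewrite big_ord0 subr0 expr0 mulr1; have -> : 1 - 1 / 2 = 2^-1 :> R by lra.
  by rewrite invrK mulrC.
(* The radii are cut off at [beta], which is reached at i = n0. *)
pose x i := Num.min beta (1 / 2 + eta' * i%:R).
have outer i t : cmod t <= x i / L w -> cmod (F (w + t *: b)) <= (2 * P) ^+ i * (2 * S).
  elim: i t => [|i IHi] t tx.
    rewrite expr0 mul1r; apply: inner; apply: le_trans tx _.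
    by rewrite ler_pM2r ?invr_gt0 // /x mulr0 addr0 ge_min lexx orbT.
  have iS : eta' * i.+1%:R = eta' * i%:R + eta' by rewrite -natr1; ring.
  have i0 : 0 <= eta' * i%:R by rewrite mulr_ge0 // ltW.
  have xi : 1 / 2 <= x i by rewrite le_min; lra.
  rewrite exprS -mulrA; apply: (propagate (x := x i) beta0 b0 LQ Fa l10 l20 P1 eta0
    (fun t => ratio w t wb) (fun t => circles w t wb) wb _ _ _ IHi tx).
  - rewrite xi /= /x iS le_min ge_min lexx /= !ge_min; apply/orP; right; lra.
  - by rewrite ge_min lexx.
  rewrite -/eta' /x iS; case: (leP beta (1 / 2 + eta' * i%:R)) => ?.
    by rewrite ge_min; apply/orP; left; lra.
  by rewrite ge_min; apply/orP; right; lra.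
have xn0 : x n0 = beta by rewrite /x; apply/min_idPl; lra.
have aQ k : alpha k <= Q * (2 * S) * (1 / beta) ^+ k.
  by apply: coef_bound => t tb; apply: outer; rewrite xn0.
(* Terms beyond [N] are at most S / 2. The alternative S <= S / 2 forces S <= 0 <= A, so S <= A in
   either case. *)
have SA : S <= Num.max A (S / 2).
  apply: ge_sup; first by exists (alpha 0%N), 0%N.
  move=> _ [k _ <-]; case: (leqP k N) => kN; first by rewrite le_max aA.
  rewrite le_max; apply/orP; right; apply: le_trans (aQ k) _.
  rewrite (_ : Q * (2 * S) * _ = S * (2 * Q * (1 / beta) ^+ k)); last ring.
  by apply: ler_wpM2l => //; have := NP k (ltnW kN); lra.
apply: le_trans (aS m) _; move: SA; rewrite le_max => /orP[//|]; lra.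
Qed.

End Propagation.

Theorem theorem11 (R : realType) (n : nat) (beta : R) (b : 'rV[R[i]]_n)
    (L : 'rV[R[i]]_n -> R) (F : 'rV[R[i]]_n -> R[i])
    (hbeta : 1 < beta) (hb : b != 0) (hL : class_Q b beta L)
    (hF : analytic_in_ball F) :
  bounded_L_index b L F <->
  forall rho : R, 0 < rho <= beta ->
    exists P2 eta : R, [/\ 1 <= P2, 0 < eta < rho &
      forall (z0 : 'rV[R[i]]_n) (t0 : R[i]),
        unit_ball R n z0 -> slice b z0 t0 ->
        exists2 r : R, eta <= r <= rho &
          circle_max b F z0 t0 (r / L (z0 + t0 *: b)) <=
            P2 * circle_min b F z0 t0 (r / L (z0 + t0 *: b))].
Proof.
split; first exact: bounded_index_circles.
exact: circles_bounded_index.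
Qed.
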